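(* Let $X$ be a separable metric space of topological dimension at most $n\geq 1$. Suppose the group $G$ acts isometrically and discretely on $X$. Then there exists a $G$-CW-complex $Y$ of dimension at most $n$ for which the stabilizers are subgroups of point stabilizers of $X$, together with a $G$-map $f: X\rightarrow Y$.
   Context: $G$ is a discrete group. $G$ acts discretely on $X$ if every orbit $G\cdot x$ is a discrete subset of $X$ (discrete in the subspace topology). A $G$-map is a continuous $G$-equivariant map. Topological dimension is covering dimension: the infimum of the integers $d\ge 0$ such that every open cover of $X$ has an open refinement in which any $d+2$ pairwise distinct members have empty intersection. *)

(* Defs.v *)
From HB Require Import structures.
From mathcomp Require Import all_boot all_order all_algebra.
From mathcomp Require Import all_classical all_reals all_analysis.

Set Implicit Arguments.
Unset Strict Implicit.
Unset Printing Implicit Defensive.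

Import Order.TTheory GRing.Theory Num.Theory.
Import numFieldNormedType.Exports.

Local Open Scope classical_set_scope.
Local Open Scope ring_scope.

Definition separable (T : topologicalType) : Prop :=
  exists2 D : set T, countable D & dense D.

Definition is_open_cover (T : topologicalType) (U : set (set T)) : Prop :=
  U `<=` open /\ \bigcup_(A in U) A = [set: T].

Definition refines (T : Type) (V U : set (set T)) : Prop :=
  forall B, V B -> exists2 A, U A & B `<=` A.

Definition covering_property (T : topologicalType) (d : nat) : Prop :=
  forall U : set (set T), is_open_cover U ->
    exists V : set (set T), [/\ is_open_cover V, refines V U &
      forall B : 'I_d.+2 -> set T, injective B -> (forall i, V (B i)) ->
        \bigcap_i B i = set0].

(* The infimum is taken in the extended reals, so that it is +oo when no [d]
   has the covering property. *)
Definition covering_dim (R : realType) (T : topologicalType) : \bar R :=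
  ereal_inf [set d%:R%:E | d in covering_property T].

Definition is_action (G : groupType) (T : Type) (act : G -> T -> T) : Prop :=
  (forall x, act 1%g x = x) /\
  (forall g h x, act (g * h)%g x = act g (act h x)).

Definition act_orbit (G : groupType) (T : Type) (act : G -> T -> T) (x : T) :
    set T :=
  range (act^~ x).

Definition stabilizer (G : groupType) (T : Type) (act : G -> T -> T) (x : T) :
    set G :=
  [set g | act g x = x].

Definition equivariant (G : groupType) (S T : Type) (actS : G -> S -> S)
    (actT : G -> T -> T) (f : S -> T) : Prop :=
  forall g x, f (actS g x) = actT g (f x).

Definition isometric_action (G : groupType) (R : realType) (X : metricType R)
    (act : G -> X -> X) : Prop :=
  forall g x y, mdist (act g x) (act g y) = mdist x y.

(* [set_type A] carries the subspace topology. *)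
Definition discrete_action (G : groupType) (T : topologicalType)
    (act : G -> T -> T) : Prop :=
  forall (x : T) (B : set (set_type (act_orbit act x))), open B.

Section equivariant_cells.
Context {G : groupType}.

Definition ltranslate (g : G) (A : set G) : set G := [set (g * a)%g | a in A].

Definition lcosets (H : set G) : set (set G) := range (ltranslate^~ H).

Definition coset_space (H : set G) : Type :=
  discrete_topology (set_type (lcosets H)).

HB.instance Definition _ (H : set G) :=
  DiscreteTopology.copy (coset_space H)
    (discrete_topology (set_type (lcosets H))).

Lemma ltranslate_lcosets (H : set G) (g : G) :
  {homo ltranslate g : A / lcosets H A}.
Proof.
move=> _ [h _ <-]; exists (g * h)%g => //.
by rewrite /ltranslate image_comp; apply: eq_imagel => a _ /=; rewrite mulgA.
Qed.

Definition coset_act (H : set G) (g : G) : coset_space H -> coset_space H :=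
  sigLR (mkfun (@ltranslate_lcosets H g)).

(* The coproduct of the spaces G/H_i * B over i : I. *)
Definition orbit_coprod (I : choiceType) (H : I -> set G)
    (B : topologicalType) : Type :=
  {i : I & (coset_space (H i) * B)%type}.

HB.instance Definition _ (I : choiceType) (H : I -> set G)
  (B : topologicalType) :=
  Topological.copy (orbit_coprod H B)
    {i : I & (coset_space (H i) * B)%type}.

Definition orbit_coprod_act (I : choiceType) (H : I -> set G)
    (B : topologicalType) (g : G) (p : orbit_coprod H B) : orbit_coprod H B :=
  existT _ (projT1 p) (coset_act g (projT2 p).1, (projT2 p).2).

Definition orbit_coprod_map (I : choiceType) (H : I -> set G)
    (B C : topologicalType) (f : B -> C) (p : orbit_coprod H B) :
    orbit_coprod H C :=
  existT _ (projT1 p) ((projT2 p).1, f (projT2 p).2).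

End equivariant_cells.

Section disks.
Variables (R : realType) (k : nat).

(* Spelled out because the library norm on ['rV[R]_k] is the sup norm. *)
Definition disk : set 'rV[R]_k := [set x | \sum_i x ord0 i ^+ 2 <= 1].

Definition sphere : set 'rV[R]_k := [set x | \sum_i x ord0 i ^+ 2 = 1].

Lemma sphere_disk : sphere `<=` disk.
Proof. by move=> x; rewrite /sphere /disk /= => ->. Qed.

End disks.

Definition subset_incl (T : Type) (A B : set T) (AB : A `<=` B) :
    set_type A -> set_type B :=
  sigLR (incl AB).

(* The square
     A -f-> B
     |g     |i
     C -j-> D
   is a pushout of topological spaces. *)
Definition is_pushout (A B C D : topologicalType)
    (f : A -> B) (g : A -> C) (i : B -> D) (j : C -> D) : Prop :=
  [/\ continuous f, continuous g, continuous i & continuous j] /\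
  i \o f = j \o g /\
  forall (T : topologicalType) (u : B -> T) (v : C -> T),
    continuous u -> continuous v -> u \o f = v \o g ->
    exists! w : D -> T, [/\ continuous w, w \o i = u & w \o j = v].

(* [pskel skel k] is the (k - 1)-skeleton, the (-1)-skeleton being empty. *)
Definition pskel (Y : Type) (skel : nat -> set Y) (k : nat) : set Y :=
  if k is k'.+1 then skel k' else set0.

(* [skel k] arises from [pskel skel k] as the pushout
     coprod_i G/H_i * S^(k-1) -> pskel skel k
              |                      |
     coprod_i G/H_i * D^k     ->  skel k
   and [Y] has the colimit topology of its skeleta. *)
Record GCW_structure (R : realType) (G : groupType) (Y : topologicalType)
    (act : G -> Y -> Y) := GCWStructure {
  gcw_action : is_action act;
  gcw_continuous : forall g, continuous (act g);
  skel : nat -> set Y;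
  skelS : forall k, pskel skel k `<=` skel k;
  skel_act : forall k g y, skel k y -> skel k (act g y);
  cell : nat -> choiceType;
  isotropy : forall k, cell k -> set G;
  isotropy_group : forall k (i : cell k), group_closed [in isotropy i];
  attach : forall k,
    orbit_coprod (@isotropy k) (set_type (@sphere R k)) ->
    set_type (pskel skel k);
  charac : forall k,
    orbit_coprod (@isotropy k) (set_type (@disk R k)) ->
    set_type (skel k);
  attach_equivariant : forall k,
    equivariant (@orbit_coprod_act _ _ _ _) act (set_val \o attach (k := k));
  charac_equivariant : forall k,
    equivariant (@orbit_coprod_act _ _ _ _) act (set_val \o charac (k := k));
  skel_pushout : forall k,
    is_pushout (attach (k := k))
      (orbit_coprod_map (subset_incl (@sphere_disk R k)))
      (subset_incl (@skelS k)) (charac (k := k));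
  skel_cover : \bigcup_k skel k = [set: Y];
  skel_colimit : forall C : set Y,
    (forall k, closed (set_val @^-1` C : set (set_type (skel k)))) -> closed C
}.

Definition GCW_dim_le (R : realType) (G : groupType) (Y : topologicalType)
    (act : G -> Y -> Y) (cw : GCW_structure R act) (n : nat) : Prop :=
  skel cw n = [set: Y].

(* Main.v *)
From HB Require Import structures.
Require Import Defs.
From mathcomp Require Import all_boot all_order all_algebra.
From mathcomp Require Import all_classical all_reals all_analysis.
From mathcomp Require Import ring lra.

(** An isometric action whose orbits are discrete has uniformly discrete orbits:
each point [x] has a radius [q] such that [act g x] is either [x] or at distance
at least [q] from it. Hence small balls around [x] are slices: their translates
are disjoint unless equal, and only elements that fix [x] preserve them. The map
wanted is the nerve map of a [G]-invariant cover by such translates, and two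
things have to be arranged: at most [n + 1] members of the cover meet, and the
nerve is a [G]-CW-complex.

The bound on the multiplicity amounts to the statement that the orbit space has
dimension at most [n]. The orbit space is never formed; open sets of it are
invariant open sets of [X], and distances to invariant sets are invariant
functions. Let [X_q] be the closed set of points with radius at least [q]. On a
piece [K] of [X_q] of small diameter the projection to the orbit space is
injective and the saturation of a closed subset of [K] is closed, so an
invariant cover can be refined, using the dimension of [X], so as to have
multiplicity at most [n + 1] on the saturation of [K] ([invariant_refine]).
Countably many such [K] have saturations that cover [X], because [X] is
separable ([tubes]). Treating them one after the other, and shrinking the
closures at each step, gives in the limit a closed cover of multiplicity at most
[n + 1] ([closed_cover_of_multiplicity]); this is the proof of the countable sum
theorem of dimension theory. A locally finite closed cover swells to an open one
without gaining intersections ([swelling]). The outcome is a locally finite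
family of invariant functions [w j], each supported in a tube, that is, in the
union of the translates of one ball ([invariant_partition]).

The vertices of the nerve are pairs [(j, z)] where [z] is the centre of a
translate of the ball of index [j]. A vertex is coloured by its index. Translates
with the same index are disjoint, so the vertices of a simplex have distinct
colours, and an element of [G] that preserves a simplex fixes each of its
vertices. For such a complex the geometric realization with the weak topology is
a [G]-CW-complex with one cell for each orbit of simplices
([realization_GCW]); the only analytic ingredient is a homeomorphism from the
round disk to the simplex ([barycentric]). The stabilizer of a point of the
realization is contained in the stabilizer of a vertex [(j, z)] of its carrier,
which is the stabilizer of the point [z] of [X] ([realization_stabilizer]).
Normalizing the functions [w j] gives the barycentric coordinates of the map
([slice_map]); it is continuous for the weak topology because near each point of
[X] only finitely many vertices are involved. *)

Set Implicit Arguments.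
Unset Strict Implicit.
Unset Printing Implicit Defensive.

Import Order.TTheory GRing.Theory Num.Theory.
Import numFieldNormedType.Exports.

Local Open Scope classical_set_scope.
Local Open Scope ring_scope.

(** * Distances capped at 1 *)

Section capped_infimum.
Variable R : realType.
Implicit Types (S T : set R) (c d s : R).

(** The cap makes the infimum meaningful for the empty set, and bounded, so that
distances to arbitrary sets and infima of distances need no case analysis. *)
Definition capinf S := inf ([set 1] `|` S).

Lemma capinf_ge S c : c <= 1 -> (forall s, S s -> c <= s) -> c <= capinf S.
Proof.
move=> c1 cS; apply: lb_le_inf; first by exists 1; left.
by move=> s [->//|/cS].
Qed.

Lemma capinf_le S s : (forall s, S s -> 0 <= s) -> S s -> capinf S <= s.
Proof.
move=> S0 Ss; apply: ge_inf; last by right.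
by exists 0 => t [->|/S0].
Qed.

Lemma capinf_le1 S : (forall s, S s -> 0 <= s) -> capinf S <= 1.
Proof.
move=> S0; apply: ge_inf; last by left.
by exists 0 => t [->|/S0].
Qed.

(** An infimum of 1-Lipschitz functions is 1-Lipschitz; both the distance to a
set and the function [r] of [swelling] are obtained in this way. *)
Lemma capinf_leD S T d : (forall s, S s -> 0 <= s) -> 0 <= d ->
  (forall s, T s -> exists2 t, S t & t <= s + d) -> capinf S <= capinf T + d.
Proof.
move=> S0 d0 ST; rewrite -lerBlDr; apply: capinf_ge.
  by rewrite lerBlDr (le_trans (capinf_le1 S0))// lerDl.
move=> s /ST[t St ts]; rewrite lerBlDr; exact: le_trans (capinf_le S0 St) ts.
Qed.

End capped_infimum.

Section metric_tools.
Variables (R : realType) (X : metricType R).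
Implicit Types (A : set X) (x y z : X) (f : X -> R).

Lemma nbhs_mdist x A :
  nbhs x A <-> exists2 e : R, 0 < e & forall y, mdist x y < e -> A y.
Proof.
split=> [/nbhs_ballP[e /= e0 eA]|[e e0 eA]].
  by exists e => // y xy; apply: eA; rewrite ballEmdist.
by apply/nbhs_ballP; exists e => // y; rewrite ballEmdist => /eA.
Qed.

Lemma open_mdist A : open A <->
  forall x, A x -> exists2 e : R, 0 < e & forall y, mdist x y < e -> A y.
Proof.
by rewrite openE; split=> oA x /oA /nbhs_mdist.
Qed.

Lemma open_forall_lt (u : nat -> X -> R) c m : (forall i, continuous (u i)) ->
  open [set x | forall i, (i < m)%N -> u i x < c].
Proof.
move=> cu; elim: m => [|m IH].
  by rewrite (_ : mkset _ = setT); [exact: openT|apply/seteqP; split].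
rewrite (_ : mkset _ = [set x | forall i, (i < m)%N -> u i x < c] `&`
    (u m @^-1` [set y | y < c])).
  apply: openI => //; apply: open_comp; last exact: open_lt.
  by move=> x _; exact: cu.
apply/seteqP; split=> x /=.
  by move=> h; split => [i im|]; apply: h => //; exact: leqW.
by move=> [h hm] i; rewrite ltnS leq_eqVlt => /orP[/eqP->|/h].
Qed.

Lemma closed_mdist A : closed A <->
  forall x, ~ A x -> exists2 e : R, 0 < e & forall y, A y -> e <= mdist x y.
Proof.
rewrite -openC open_mdist; split=> cA x /cA[e e0 eA]; exists e => // y.
  by move=> Ay; rewrite leNgt; apply/negP => /eA.
by move=> xy /eA; rewrite leNgt xy.
Qed.

Definition nonexpansive f := forall x y, f x <= f y + mdist x y.

Lemma nonexpansive_continuous f : nonexpansive f -> continuous f.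
Proof.
move=> lf x; apply/cvgrPdist_lt => e e0; apply/nbhs_mdist; exists e => //.
move=> y xy; have := lf x y; have := lf y x; rewrite (metric_sym y x) => h1 h2.
rewrite ltr_norml; apply/andP; split; lra.
Qed.

Definition setdist A x : R := capinf [set mdist x a | a in A].

Lemma setdist_ge0 A x : 0 <= setdist A x.
Proof. by apply: capinf_ge => // _ [a _ <-]; exact: mdist_ge0. Qed.

Lemma setdist_le1 A x : setdist A x <= 1.
Proof. by apply: capinf_le1 => _ [a _ <-]; exact: mdist_ge0. Qed.

Lemma setdist_le A a x : A a -> setdist A x <= mdist x a.
Proof.
by move=> Aa; apply: capinf_le; [move=> _ [b _ <-]; exact: mdist_ge0|exists a].
Qed.

Lemma setdist_eq0 A x : A x -> setdist A x = 0.
Proof.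
move=> Ax; apply/eqP; rewrite eq_le setdist_ge0 andbT.
by rewrite (le_trans (setdist_le _ Ax))// mdistxx.
Qed.

Lemma setdist_lip A : nonexpansive (setdist A).
Proof.
move=> x y; apply: capinf_leD; first by move=> _ [a _ <-]; exact: mdist_ge0.
  exact: mdist_ge0.
move=> _ [a Aa <-]; exists (mdist x a); first by exists a.
by rewrite addrC metric_triangle.
Qed.

Lemma setdist_gt0 A x : closed A -> ~ A x -> 0 < setdist A x.
Proof.
move=> /closed_mdist cA /cA[e e0 eA].
suff : Num.min e 1 <= setdist A x.
  by apply: lt_le_trans; rewrite lt_min e0 ltr01.
apply: capinf_ge; first by rewrite ge_min lexx orbT.
by move=> _ [a Aa <-]; rewrite ge_min eA.
Qed.

Lemma setdistC_gt0 A x : open A -> (0 < setdist (~` A) x) <-> A x.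
Proof.
move=> oA; split=> [d0|Ax].
  by apply: contrapT => nAx; move: d0; rewrite setdist_eq0 ?ltxx.
by apply: setdist_gt0; [rewrite closedC|exact].
Qed.

End metric_tools.

(** * Invariant covers of bounded multiplicity *)

Section invariant_covers.
Variables (R : realType) (G : groupType) (X : metricType R) (act : G -> X -> X).
Hypotheses (act_action : is_action act) (act_isom : isometric_action act).
Implicit Types (A C K : set X) (U V W : nat -> set X).

Definition act_invariant A := forall g x, A x -> A (act g x).

Definition saturation A : set X :=
  [set y | exists g, exists2 a, A a & y = act g a].

Lemma act1 x : act 1%g x = x. Proof. exact: act_action.1. Qed.
Lemma actM g h x : act (g * h)%g x = act g (act h x).
Proof. exact: act_action.2. Qed.
Lemma actK g x : act g^-1%g (act g x) = x.
Proof. by rewrite -actM mulVg act1. Qed.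
Lemma actVK g x : act g (act g^-1%g x) = x.
Proof. by rewrite -actM mulgV act1. Qed.

Lemma mdist_actl g x y : mdist (act g x) y = mdist x (act g^-1%g y).
Proof. by rewrite -[in LHS](actVK g y) act_isom. Qed.

Lemma invariantE A g x : act_invariant A -> A (act g x) <-> A x.
Proof. by move=> iA; split=> [/(iA g^-1%g)|/iA//]; rewrite actK. Qed.

Lemma invariantC A : act_invariant A -> act_invariant (~` A).
Proof. by move=> iA g x nAx /(invariantE _ _ iA). Qed.

Lemma saturation_invariant A : act_invariant (saturation A).
Proof.
by move=> g _ [h [a Aa ->]]; exists (g * h)%g, a => //; rewrite actM.
Qed.

Lemma sub_saturation A : A `<=` saturation A.
Proof. by move=> x Ax; exists 1%g, x => //; rewrite act1. Qed.

Lemma setdist_inv A g x : act_invariant A -> setdist A (act g x) = setdist A x.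
Proof.
move=> iA; rewrite /setdist; congr capinf; apply/seteqP; split=> _ [a Aa <-].
  by exists (act g^-1%g a); [exact: iA|rewrite -mdist_actl].
by exists (act g a); [exact: iA|rewrite mdist_actl actK].
Qed.

(** At most [n + 1] of the sets contain [x]: the convention for covers of a space
of dimension [n]. *)
Definition multiplicity_le U n x :=
  forall B : 'I_n.+2 -> nat, injective B -> ~ (forall i, U (B i) x).

Lemma multiplicity_le_sub U V n x : (forall j, U j `<=` V j) ->
  multiplicity_le V n x -> multiplicity_le U n x.
Proof. by move=> UV mV B /mV BV UB; apply: BV => i; apply: UV. Qed.

Definition invariant_cover U :=
  [/\ forall j, open (U j), forall j, act_invariant (U j)
    & forall x, exists j, U j x].

(** The projection to the orbit space is injective on such a set ([thin_orbit]);
that [r] is uniform makes it a closed map there ([saturation_closed]). *)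
Definition thin K := exists2 r : R, 0 < r &
  forall c c' h, K c -> K c' -> mdist c (act h c') < r -> act h c' = c'.

(** Near a point [y], all translates of points of [C] lie in a single translate
[act g @` C]: two such points are close to each other, and thinness moves one to
the translate that contains the other. *)
Lemma saturation_closed K C : thin K -> C `<=` K -> closed C ->
  closed (saturation C).
Proof.
move=> [r r0 rK] CK /closed_mdist cC; apply/closed_mdist => y ny.
have [[g [c [Cc ygc]]]|far] :=
    pselect (exists g c, C c /\ mdist y (act g c) < r / 2); last first.
  exists (r / 2); first by rewrite divr_gt0.
  move=> _ [g [c Cc ->]]; rewrite leNgt; apply/negP => h; apply: far.
  by exists g, c.
have nC : ~ C (act g^-1%g y).
  by move=> Cy; apply: ny; exists g, (act g^-1%g y) => //; rewrite actVK.
have [e e0 eC] := cC _ nC.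
exists (Num.min e (r / 2)); first by rewrite lt_min e0 divr_gt0.
move=> _ [h [b Cb ->]].
rewrite leNgt; apply/negP; rewrite lt_min => /andP[h1 h2].
have hb : mdist c (act (g^-1 * h)%g b) < r.
  rewrite actM -mdist_actl; apply: le_lt_trans (metric_triangle _ y _) _.
  by rewrite (splitr r) ltrD// metric_sym.
have {}hb := rK _ _ _ (CK _ Cc) (CK _ Cb) hb.
have := eC _ Cb; rewrite -hb actM metric_sym -mdist_actl actVK metric_sym.
by rewrite leNgt h1.
Qed.

Lemma thin_orbit K c h : thin K -> K c -> K (act h c) -> act h c = c.
Proof.
move=> [r r0 rK] Kc Khc; apply: (rK (act h c) c h) => //.
by rewrite mdistxx.
Qed.

(** A closed subspace inherits the covering property: refine the cover that
consists of the [U j] and the complement of [K], then unite the members that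
meet [K] and were assigned to the same index. Distinct indices then come from
distinct members, so the multiplicity does not grow. *)
Lemma closed_refine K U d : closed K -> covering_property X d ->
  (forall j, open (U j)) -> (forall x, exists j, U j x) ->
  exists W, [/\ forall j, open (W j), forall j, W j `<=` U j,
     forall x, K x -> exists j, W j x & forall x, K x -> multiplicity_le W d x].
Proof.
move=> cK dimX oU cU.
have [|V [[oV cV] VU Vd]] := dimX ([set U j | j in setT] `|` [set ~` K]).
  split; first by move=> _ [[j _ <-]|->]; [exact: oU|rewrite openC].
  rewrite -subTset => x _; have [j Ujx] := cU x.
  by exists (U j) => //; left; exists j.
have /choice[a aP] : forall B : set X, exists j,
    V B -> B `&` K !=set0 -> B `<=` U j.
  move=> B; have [[VB [b [Bb Kb]]]|nB] := pselect (V B /\ B `&` K !=set0).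
    have [_ [[j _ <-]|->] BA] := VU _ VB; first by exists j.
    by have /= := BA _ Bb.
  by exists 0%N => VB BK; case: nB.
exists (fun j => \bigcup_(B in [set B | [/\ V B, B `&` K !=set0 & a B = j]]) B).
split.
- by move=> j; apply: bigcup_open => B [VB _ _]; exact: oV.
- by move=> j x [B [VB BK <-] Bx]; exact: aP Bx.
- move=> x Kx; have : setT x by [].
  rewrite -cV => -[B VB Bx]; exists (a B), B => //; split => //.
  by exists x.
- move=> x Kx B injB Bx; pose b i := sval (cid2 (Bx i)).
  have bP i : [/\ V (b i), a (b i) = B i & b i x].
    by rewrite /b; case: cid2 => D [] /=.
  have binj : injective b.
    move=> i j bij; apply: injB.
    by have [_ <- _] := bP i; have [_ <- _] := bP j; rewrite bij.
  have /= := Vd b binj (fun i => let: And3 v _ _ := bP i in v).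
  by move/seteqP => [/(_ x) + _]; apply => i _; have [] := bP i.
Qed.

(** The saturation of [K] meets each orbit in translates of one point of [K], so
a refinement on [K] carries over to the saturation; removing from [U j] the
saturation of what [W j] misses in [K] realizes it by invariant sets that are
open because that saturation is closed. *)
Lemma invariant_refine K U d : closed K -> thin K -> covering_property X d ->
  invariant_cover U ->
  exists W, [/\ invariant_cover W, forall j, W j `<=` U j
    & forall x, saturation K x -> multiplicity_le W d x].
Proof.
move=> cK tK dimX [oU iU cU].
have [W [oW WU cW mW]] := closed_refine cK dimX oU cU.
pose S j := saturation (K `\` W j).
have Wor j g x : K x -> (U j `\` S j) (act g x) -> W j x.
  move=> Kx [_ nS]; apply: contrapT => nW; apply: nS.
  by exists g, x.
exists (fun j => U j `\` S j); split; [split| |].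
- move=> j; rewrite setDE; apply: openI => //; rewrite openC.
  apply: (saturation_closed tK); first by move=> x [].
  by rewrite setDE; apply: closedI => //; rewrite closedC.
- move=> j g x [Ux nSx]; split; first exact: iU.
  exact: invariantC (@saturation_invariant _) _ _ nSx.
- move=> x; have [[g [c Kc ->]]|nK] := pselect (saturation K x).
    have [j Wc] := cW c Kc; exists j; split; first by apply/iU/WU.
    move=> [h [b [Kb nWb]] e].
    have cb : c = act (g^-1 * h)%g b by rewrite actM -e actK.
    have : K (act (g^-1 * h)%g b) by rewrite -cb.
    by move=> /(thin_orbit tK Kb); rewrite -cb => cb'; apply: nWb; rewrite -cb'.
  have [j Ujx] := cU x; exists j; split => // -[g [c [Kc _] e]].
  by apply: nK; exists g, c.
- by move=> j x [].
- move=> _ [g [c Kc ->]] B injB BS; apply: (mW c Kc B injB) => i.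
  exact: (Wor _ g).
Qed.

(** The members are compared through [u j], the distance to the complement of
[U j]: keep the points where [u j] exceeds half of the supremum over all
indices. The supremum is continuous because each [u j] is 1-Lipschitz. *)
Lemma closed_shrinking U : invariant_cover U ->
  exists (V C : nat -> set X), [/\ invariant_cover V, forall j, closed (C j),
    forall j, V j `<=` C j & forall j, C j `<=` U j].
Proof.
move=> [oU iU cU].
pose u j := setdist (~` U j).
pose m x := sup (range (u ^~ x)).
have hs x : has_sup (range (u ^~ x)).
  split; first by exists (u 0%N x), 0%N.
  by exists 1 => _ [j _ <-]; exact: setdist_le1.
have um j x : u j x <= m x by apply: sup_upper_bound => //; exists j.
have mlip : nonexpansive m.
  move=> x y; apply: ge_sup; first by exists (u 0%N x), 0%N.
  move=> _ [j _ <-]; apply: le_trans (setdist_lip _ x y) _.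
  by rewrite lerD2r um.
have m0 x : 0 < m x.
  have [j Ujx] := cU x; apply: lt_le_trans (um j x).
  exact/setdistC_gt0.
have minv g x : m (act g x) = m x.
  congr sup; apply/seteqP; split=> _ [j _ <-]; exists j => //.
    by rewrite /u setdist_inv//; exact: invariantC.
  by rewrite /u setdist_inv//; exact: invariantC.
have uc j : continuous (u j) by apply/nonexpansive_continuous/setdist_lip.
have fc j : continuous (fun x => u j x - m x / 2).
  move=> x; apply: cvgB; first exact: uc.
  by apply: cvgM; [exact/nonexpansive_continuous|exact: cvg_cst].
have fE j x : (u j x - m x / 2 > 0) = (m x / 2 < u j x) by rewrite subr_gt0.
exists (fun j => [set x | 0 < u j x - m x / 2]),
  (fun j => [set x | 0 <= u j x - m x / 2]); split.
- split=> [j|j g x|x] /=.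
  + exact: open_comp (fun x _ => fc j x) (@open_gt _ 0).
  + by rewrite minv /u setdist_inv//; exact: invariantC.
  + have [_ [j _ <-] h] := @sup_adherent _ _ (m x / 2)
      (divr_gt0 (m0 x) (ltr0Sn _ 1)) (hs x).
    exists j; move: h; rewrite -/(m x); lra.
- by move=> j; exact: closed_comp (fun x _ => fc j x) (@closed_ge _ 0).
- by move=> j x /ltW.
- move=> j x /= h; apply/setdistC_gt0 => //; rewrite -/(u j x).
  have := m0 x; lra.
Qed.

Definition locally_finite U := forall x : X, exists M : nat,
  \forall y \near x, forall j, (M <= j)%N -> ~ U j y.

(** The standard refinement of a countable cover: from [U j], discard the points
that lie deep in a set of smaller index. *)
Lemma locally_finite_refine U : invariant_cover U ->
  exists V, [/\ invariant_cover V, locally_finite V & forall j, V j `<=` U j].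
Proof.
move=> [oU iU cU].
pose u j := setdist (~` U j).
have uc j : continuous (u j) by apply/nonexpansive_continuous/setdist_lip.
have uinv j g x : u j (act g x) = u j x.
  by rewrite /u setdist_inv//; exact: invariantC.
exists (fun j => U j `&` [set x | forall i, (i < j)%N -> u i x < j.+1%:R^-1]).
split; last by move=> j x [].
- split=> [j|j g x [Ux h]|x].
  + by apply: openI => //; exact: open_forall_lt.
  + by split; [exact: iU|move=> i /h; rewrite uinv].
  + have ex : exists j, `[< U j x >].
      by have [j Uj] := cU x; exists j; apply/asboolP.
    case: (ex_minnP ex) => j /asboolP Ujx jmin; exists j; split => // i ij.
    rewrite /u setdist_eq0 ?invr_gt0 ?ltr0Sn// => Ui.
    by have := jmin i (asboolT Ui); rewrite leqNgt ij.
- move=> x; have [i Uix] := cU x.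
  have ui : 0 < u i x by apply/setdistC_gt0.
  have [M Mlt] : exists M : nat, M.+1%:R^-1 < u i x.
    exists (Num.bound (u i x)^-1); rewrite invf_plt ?posrE// ?ltr0Sn//.
    apply: lt_trans (archi_boundP _) _; rewrite ?ltr_nat//.
    by rewrite invr_ge0 ltW.
  exists (maxn i.+1 M.+1).
  have := cvgr_gt (u i x) (uc i x) _ Mlt; move=> /(_ _).
  apply: filterS => y Muy j; rewrite geq_max => /andP[ij Mj] [_ /(_ i ij)].
  apply/negP; rewrite -leNgt; apply: le_trans (ltW Muy).
  by rewrite lef_pV2 ?posrE ?ltr0Sn// ler_nat ltnW.
Qed.

(** The countable sum theorem, in the form needed here. The covers [T i] shrink,
with [T i.+1] of multiplicity at most [d + 1] on the saturation of [K i] and with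
closed sets [C i] squeezed between [T i.+1] and [T i]. The intersections over
[i] are thus closed, and they still cover since each point lies in finitely many
members of [U]. *)
Lemma closed_cover_of_multiplicity (K : nat -> set X) U d :
  (forall i, closed (K i)) -> (forall i, thin (K i)) ->
  (forall x, exists i, saturation (K i) x) ->
  covering_property X d -> invariant_cover U -> locally_finite U ->
  exists V, [/\ forall j, closed (V j), forall j, act_invariant (V j),
    forall j, V j `<=` U j,
    forall x, exists j, V j x & forall x, multiplicity_le V d x].
Proof.
move=> cK tK sK dimX icU lfU.
pose fam := nat -> set X.
have /choice[F FP] : forall p : nat * fam, exists q : fam * fam,
    invariant_cover p.2 ->
    [/\ invariant_cover q.1, forall j, closed (q.2 j),
      forall j, q.1 j `<=` q.2 j, forall j, q.2 j `<=` p.2 j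
      & forall x, saturation (K p.1) x -> multiplicity_le q.1 d x].
  move=> [i W].
  have [icW|] := pselect (invariant_cover W); last by exists (W, W).
  have [W' [icW' WW' mW']] := invariant_refine (cK i) (tK i) dimX icW.
  have [V [C [icV cC VC CW']]] := closed_shrinking icW'.
  exists (V, C) => _; split => //= [j x|x /mW'].
    by move=> /CW' /WW'.
  by apply: multiplicity_le_sub => j y /VC /CW'.
pose T := fix T i := if i is i'.+1 then (F (i', T i')).1 else U.
pose C i := (F (i, T i)).2.
have Tic i : invariant_cover (T i).
  by elim: i => //= i /(FP (i, T i))[].
have TC i j : T i.+1 j `<=` C i j.
  by have [_ _ h _ _] := FP (i, T i) (Tic i); exact: h.
have CT i j : C i j `<=` T i j.
  by have [_ _ _ h _] := FP (i, T i) (Tic i); exact: h.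
have Tdec i k j : (i <= k)%N -> T k j `<=` T i j.
  elim: k => [|k IH]; first by rewrite leqn0 => /eqP ->.
  rewrite leq_eqVlt => /orP[/eqP -> //|/IH ik x].
  by move=> /TC /CT /ik.
exists (fun j => \bigcap_i C i j); split.
- move=> j; apply: closed_bigI => i _.
  by have [_ h _ _ _] := FP (i, T i) (Tic i); exact: h.
- move=> j g x Vx i _; apply: TC.
  by have [_ iT _] := Tic i.+1; apply: iT; exact/CT/Vx.
- by move=> j x /(_ 0%N I) /CT.
- move=> x; have [M /nbhs_singleton Mx] := lfU x.
  apply: contrapT => nV.
  have : forall m, exists i, forall j, (j < m)%N -> ~ T i j x.
    elim=> [|m [i im]]; first by exists 0%N.
    have [k nk] : exists k, ~ C k m x.
      apply: contrapT => nk; apply: nV; exists m => k _.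
      by apply: contrapT => nC; apply: nk; exists k.
    exists (maxn i k.+1) => j; rewrite ltnS leq_eqVlt => /orP[/eqP ->|/im nT].
      by move=> /(Tdec _ _ _ (leq_maxr i k.+1)) /TC.
    by move=> /(Tdec _ _ _ (leq_maxl i k.+1)).
  move=> /(_ M)[i iM]; have [_ _ /(_ x)[j Tj]] := Tic i.
  have [/iM//|Mj] := ltnP j M.
  exact: Mx _ Mj (Tdec _ _ _ (leq0n i) _ Tj).
- move=> x; have [i Kx] := sK x.
  have [_ _ _ _ /(_ x Kx)] := FP (i, T i) (Tic i).
  by apply: multiplicity_le_sub => j y /(_ i.+1 I) /CT h; exact: h.
Qed.

(** Let [r x] be the (n + 2)-nd smallest distance from [x] to the sets [V j].
It is 1-Lipschitz, and positive because no [n + 2] of the closed sets [V j] meet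
and the family is locally finite.
At most [n + 1] of them are at distance less than [r x] from [x], so the open
sets where this happens have the multiplicity of the cover [V]; cutting them
off outside [U j] keeps them locally finite. *)
Lemma swelling U V n :
  (forall j, open (U j)) -> (forall j, act_invariant (U j)) ->
  locally_finite U -> (forall j, closed (V j)) -> (forall j, act_invariant (V j)) ->
  (forall j, V j `<=` U j) ->
  (forall x, exists j, V j x) -> (forall x, multiplicity_le V n x) ->
  exists w : nat -> X -> R, [/\ forall j, continuous (w j),
    forall j x, 0 <= w j x, forall j g x, w j (act g x) = w j x,
    forall j x, 0 < w j x -> U j x &
    (forall x, exists j, 0 < w j x) /\
    forall x, multiplicity_le (fun j => [set y | 0 < w j y]) n x].
Proof.
move=> oU iU lfU cV iV VU covV mV.
pose d j := setdist (V j).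
pose S x := [set s : R | 0 <= s /\ exists B : 'I_n.+2 -> nat,
  injective B /\ forall i, d (B i) x <= s].
pose r x := capinf (S x).
have S0 x s : S x s -> 0 <= s by case.
have rlip : nonexpansive r.
  move=> x y; apply: capinf_leD; [exact: S0|exact: mdist_ge0|].
  move=> s [s0 [B [injB Bs]]]; exists (s + mdist x y) => //.
  split; first by rewrite addr_ge0// mdist_ge0.
  exists B; split => // i; apply: le_trans (setdist_lip _ x y) _.
  by rewrite lerD2r Bs.
have dinv j g x : d j (act g x) = d j x by rewrite /d setdist_inv.
have rinv g x : r (act g x) = r x.
  congr capinf; apply/seteqP; split=> s [s0 [B [injB Bs]]]; split=> //;
    by exists B; split=> // i; rewrite ?dinv//; have := Bs i; rewrite dinv.
have r_gt0 x : 0 < r x.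
  (* beyond index M all sets are at distance at least e from x *)
  have [M /nbhs_mdist[e e0 eM]] := lfU x.
  have [c c0 cM] : exists2 c : R, 0 < c &
      forall j, (j < M)%N -> ~ V j x -> c <= d j x.
    elim: M {eM} => [|M [c c0 IH]]; first by exists 1.
    have [Vx|nVx] := pselect (V M x).
      by exists c => // j; rewrite ltnS leq_eqVlt => /orP[/eqP->|/IH].
    exists (Num.min c (d M x)); first by rewrite lt_min c0 setdist_gt0.
    move=> j; rewrite ltnS leq_eqVlt ge_min => /orP[/eqP-> _|jM nV].
      by rewrite lexx orbT.
    by rewrite IH.
  suff : Num.min 1 (Num.min c e) <= r x.
    by apply: lt_le_trans; rewrite !lt_min ltr01 c0.
  apply: capinf_ge; first by rewrite ge_min lexx.
  move=> s [_ [B [injB Bs]]].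
  have [i nVi] : exists i, ~ V (B i) x.
    apply: contrapT => nV; apply: (mV x B injB) => i.
    by apply: contrapT => nVi; apply: nV; exists i.
  apply: le_trans (Bs i); have [BM|BM] := ltnP (B i) M.
    by rewrite !ge_min cM ?orbT.
  apply: capinf_ge; first by rewrite ge_min lexx.
  move=> _ [y Vy <-]; rewrite !ge_min; apply/orP; right; apply/orP; right.
  by rewrite leNgt; apply/negP => /eM /(_ _ BM); apply; exact: VU.
have rc : continuous r by apply: nonexpansive_continuous.
have dc j : continuous (d j) by apply/nonexpansive_continuous/setdist_lip.
pose u j := setdist (~` U j).
have uc j : continuous (u j) by apply/nonexpansive_continuous/setdist_lip.
pose w j x := Num.max 0 (r x - d j x) * u j x.
have w_gt0 j x : 0 < w j x -> d j x < r x /\ U j x.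
  move=> w0; have u0 : 0 < u j x.
    rewrite lt_neqAle setdist_ge0 andbT; apply/negP => /eqP u0.
    by move: w0; rewrite /w -u0 mulr0 ltxx.
  split; last exact/setdistC_gt0.
  by move: w0; rewrite /w pmulr_lgt0// lt_max ltxx/= subr_gt0.
exists w; split; [| | | |split].
- move=> j x; apply: cvgM; last exact: uc.
  apply: (@continuous_max _ _ (fun=> 0) (fun x => r x - d j x)).
    exact: cvg_cst.
  by apply: cvgB; [exact: rc|exact: dc].
- by move=> j x; rewrite mulr_ge0 ?setdist_ge0// le_max lexx.
- move=> j g x; rewrite /w rinv dinv /u setdist_inv//; exact: invariantC.
- by move=> j x /w_gt0[].
- move=> x; have [j Vx] := covV x; exists j.
  rewrite /w /d (setdist_eq0 Vx) subr0 mulr_gt0 ?lt_max ?r_gt0 ?orbT//.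
  exact/setdistC_gt0/VU.
- move=> x B injB Bw.
  pose s := \big[Num.max/0]_i d (B i) x.
  have : s < r x by apply: bigmax_lt => // i _; have [] := w_gt0 _ _ (Bw i).
  apply/negP; rewrite -leNgt; apply: capinf_le; first exact: S0.
  split; first exact: bigmax_ge_id.
  by exists B; split => // i; apply: le_bigmax.
Qed.

(** * Tubes *)

Definition isolated (q : R) x :=
  forall g, mdist x (act g x) < q -> act g x = x.

(** If [act g x] is different from [x] but closer than [q], the same holds at all
points near [x]. *)
Lemma isolated_closed q : closed [set x | isolated q x].
Proof.
apply/closed_mdist => x /existsNP[g /not_implyP[gx_lt gx_neq]].
have gx_gt0 : 0 < mdist x (act g x) by rewrite mdist_gt0; apply/eqP => /esym.
pose e := Num.min (mdist x (act g x)) (q - mdist x (act g x)).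
have e0 : 0 < e by rewrite lt_min gx_gt0 subr_gt0.
have [e1 e2] : e <= mdist x (act g x) /\ e <= q - mdist x (act g x).
  by split; rewrite ge_min lexx ?orbT.
exists (e / 2); first by rewrite divr_gt0.
move=> y yk; rewrite leNgt; apply/negP => xy.
have t1 := metric_triangle y x (act g y).
have t2 := metric_triangle x (act g x) (act g y).
have t3 := metric_triangle x (act g y) (act g x).
rewrite (metric_sym y x) in t1.
rewrite act_isom in t2.
rewrite act_isom (metric_sym y x) in t3.
have /yk gy : mdist y (act g y) < q by lra.
rewrite gy in t3; lra.
Qed.

Lemma isolated_thin q K : 0 < q -> K `<=` isolated q ->
  (forall x y, K x -> K y -> mdist x y <= q / 4) -> thin K.
Proof.
move=> q0 Ki Kd.
exists (q / 2); first by rewrite divr_gt0.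
move=> c c' h Kc Kc' cc'; apply: (Ki _ Kc').
have := metric_triangle c' c (act h c'); have := Kd _ _ Kc' Kc; lra.
Qed.

Lemma discrete_isolated : discrete_action act ->
  forall x, exists k, isolated k.+1%:R^-1 x.
Proof.
move=> dis x.
have ox : act_orbit act x x by exists 1%g => //; rewrite act1.
have [U oU UE] := dis x [set z | set_val z = x].
have /open_mdist/(_ x)[|e e0 eU] := oU.
  have : [set z | set_val z = x] (SigSub (mem_set ox) : act_orbit act x) by [].
  by rewrite -UE.
exists (Num.bound e^-1) => g gx.
have ogx : act_orbit act x (act g x) by exists g.
have : (set_val @^-1` U) (SigSub (mem_set ogx) : act_orbit act x).
  apply: eU; apply: lt_trans gx _.
  rewrite invf_plt ?posrE ?ltr0Sn//.
  by apply: lt_trans (archi_boundP _) _; rewrite ?invr_ge0 ?ltW// ltr_nat.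
by rewrite UE.
Qed.

End invariant_covers.

Lemma separable_seq (R : realType) (X : metricType R) (x0 : X) : separable X ->
  exists e : nat -> X, forall x (d : R), 0 < d -> exists i, mdist (e i) x < d.
Proof.
move=> [D /countable_injP[f finj] dD].
exists (fun m => xget x0 [set x | D x /\ f x = m]) => x d d0.
have [||y [xy Dy]] := dD [set y | mdist x y < d].
- by exists x; rewrite /= mdistxx.
- apply/open_mdist => y /= xy; exists (d - mdist x y).
    by rewrite subr_gt0.
  move=> z yz; apply: le_lt_trans (metric_triangle x y z) _; lra.
exists (f y); rewrite metric_sym.
case: xgetP => [z _ [Dz fz]|]; last by move=> /(_ y)/not_andP[].
by rewrite (finj z y)// inE.
Qed.

(** Both families are indexed by pairs of a point [e i] of the dense sequence and
a radius [q k]. The points isolated with radius [q k] and close to [e i] form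
the thin set, and any one of them is the centre of a ball containing them all. *)
Lemma tubes (R : realType) (G : groupType) (X : metricType R)
    (act : G -> X -> X) (x0 : X) :
  is_action act -> isometric_action act -> discrete_action act ->
  separable X ->
  exists (c : nat -> X) (r : nat -> R) (K : nat -> set X), [/\
    forall j, 0 < r j, forall j, isolated act (4 * r j) (c j),
    forall x, exists j, mdist (c j) x < r j,
    forall i, closed (K i) /\ thin act (K i) & forall x, exists i, K i x].
Proof.
move=> aA aI aD sX; have [e eP] := separable_seq x0 sX.
pose q k : R := k.+1%:R^-1; have q0 k : 0 < q k by rewrite invr_gt0 ltr0Sn.
have [k0 x0k0] := discrete_isolated aA aD x0.
pose N i k x := isolated act (q k) x /\ mdist (e i) x <= q k / 16.
have /choice[cr crP] : forall ik : nat * nat, exists cr : X * R,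
    [/\ 0 < cr.2, isolated act (4 * cr.2) cr.1 &
       forall x, N ik.1 ik.2 x -> mdist cr.1 x < cr.2].
  move=> [i k] /=; have [[c [cq ec]]|nc] := pselect (exists c, N i k c).
    exists (c, q k / 4) => /=; split.
    - by rewrite divr_gt0.
    - by rewrite mulrC divfK.
    - move=> x [_ ex]; have := metric_triangle c (e i) x.
      have := q0 k; rewrite (metric_sym c (e i)); lra.
  (* no point is isolated near e i: any isolated point serves as a centre *)
  exists (x0, q k0 / 4) => /=; split.
  - by rewrite divr_gt0.
  - by rewrite mulrC divfK.
  - by move=> x Nx; case: nc; exists x.
pose ik m : nat * nat := odflt (0, 0)%N (unpickle m).
have ikK i k : ik (pickle (i, k)) = (i, k) by rewrite /ik pickleK.
have NP x : exists m, N (ik m).1 (ik m).2 x.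
  have [k xk] := discrete_isolated aA aD x.
  have [i ix] := eP x (q k / 16) (divr_gt0 (q0 k) (ltr0Sn _ _)).
  by exists (pickle (i, k)); rewrite ikK; split => //; exact: ltW.
exists (fun m => (cr (ik m)).1), (fun m => (cr (ik m)).2),
  (fun m => N (ik m).1 (ik m).2); split.
- by move=> m; have [] := crP (ik m).
- by move=> m; have [] := crP (ik m).
- by move=> x; have [m Nx] := NP x; exists m; have [_ _] := crP (ik m); exact.
- move=> m; move: (ik m) => [i k] /=; split.
    apply: closedI; first exact: isolated_closed.
    apply/closed_mdist => x /negP; rewrite -ltNge => ix.
    exists (mdist (e i) x - q k / 16); first by rewrite subr_gt0.
    move=> y iy; have := metric_triangle (e i) y x.
    rewrite (metric_sym y x); lra.
  apply: (isolated_thin (q0 k)); first by move=> x [].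
  move=> x y [_ ix] [_ iy]; have := metric_triangle x (e i) y.
  have := q0 k; rewrite (metric_sym x (e i)); lra.
- exact: NP.
Qed.

(** What remains of the dimension of [X]: all later arguments use only these
functions and the centres and radii of the balls. The factor 4 keeps disjoint
translates of a ball of radius [r j] at distance at least [2 * r j]. *)
Theorem invariant_partition (R : realType) (G : groupType) (X : metricType R)
    (act : G -> X -> X) (x0 : X) (n : nat) :
  is_action act -> isometric_action act -> discrete_action act ->
  separable X -> covering_property X n ->
  exists (c : nat -> X) (r : nat -> R) (w : nat -> X -> R),
  [/\ [/\ forall j, 0 < r j, forall j, isolated act (4 * r j) (c j)
       & forall j x, 0 < w j x -> exists g, mdist (act g (c j)) x < r j],
      [/\ forall j, continuous (w j), forall j x, 0 <= w j x
       & forall j g x, w j (act g x) = w j x],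
      locally_finite (fun j => [set y | 0 < w j y]),
      forall x, exists j, 0 < w j x &
      forall x, multiplicity_le (fun j => [set y | 0 < w j y]) n x].
Proof.
move=> aA aI aD sX dimX.
have [c [r [K [r0 ri cr tK Kcov]]]] := tubes x0 aA aI aD sX.
pose T j := [set x | exists g, mdist (act g (c j)) x < r j].
have icT : invariant_cover act T.
  split=> [j|j h x [g gx]|x].
  - apply/open_mdist => x [g gx]; exists (r j - mdist (act g (c j)) x).
      by rewrite subr_gt0.
    move=> y xy; exists g; have := metric_triangle (act g (c j)) x y; lra.
  - by exists (h * g)%g; rewrite (actM aA) aI.
  - by have [j cj] := cr x; exists j, 1%g; rewrite (act1 aA).
have [U [icU lfU UT]] := locally_finite_refine aA aI icT.
have [V [cV iV VU covV mV]] := closed_cover_of_multiplicity aA aI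
  (fun i => (tK i).1) (fun i => (tK i).2)
  (fun x => let: ex_intro i Kx := Kcov x in ex_intro _ i (sub_saturation aA Kx))
  dimX icU lfU.
have [oU iU _] := icU.
have [w [cw w0 iw wU [covw mw]]] := swelling aA aI oU iU lfU cV iV VU covV mV.
exists c, r, w; split => //.
- by split => // j x /wU /UT.
- move=> x; have [M nM] := lfU x; exists M; apply: filterS nM => y nU j Mj /wU.
  exact: nU.
Qed.

Lemma covering_propertyW (T : topologicalType) d n : (d <= n)%N ->
  covering_property T d -> covering_property T n.
Proof.
move=> dn dimT U /dimT[V [oV VU Vd]]; exists V; split => // B injB VB.
have le : (d.+2 <= n.+2)%N by [].
rewrite -subset0 => x Bx; have := Vd (B \o widen_ord le).
rewrite -subset0 => /(_ _ _ x); apply.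
- by move=> i j /injB /(congr1 val) /= ij; exact: val_inj.
- by move=> i; exact: VB.
- by move=> i _; exact: Bx.
Qed.

Lemma covering_dim_le (R : realType) (T : topologicalType) n :
  (covering_dim R T <= n%:R%:E)%E -> covering_property T n.
Proof.
move=> dimT; have [|_ [d dP <-]] := @ereal_inf_lt R
    [set d%:R%:E | d in covering_property T] n.+1%:R%:E.
  by apply: le_lt_trans dimT _; rewrite lte_fin ltr_nat.
by rewrite lte_fin ltr_nat ltnS => dn; exact: covering_propertyW dP.
Qed.

(** * From the round disk to the simplex *)

Section disk_to_simplex.
Variables (R : realType) (k : nat).
Implicit Types (x y : 'rV[R]_k) (l : 'I_k.+1) (t : 'I_k.+1 -> R).

(** [simplex_shift] is the linear isomorphism from R^k to the hyperplane of
vectors of sum 0 in R^(k+1). The barycentre translates this hyperplane to the one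
spanned by the simplex, and the preimage of the simplex is the convex body
[simplex_gauge x <= 1]. *)
Definition simplex_shift x l : R :=
  if unlift ord_max l is Some i then x ord0 i else - \sum_i x ord0 i.

Definition euclid x : R := Num.sqrt (\sum_i x ord0 i ^+ 2).

Definition simplex_gauge x : R :=
  k.+1%:R * \big[Num.max/0]_l - simplex_shift x l.

(** The radial homeomorphism from the disk to the simplex: each ray is rescaled so
that the gauge of the image is the Euclidean norm of the argument. At the origin
the shift vanishes, so the junk value of the quotient is harmless. *)
Definition barycentric x l : R :=
  k.+1%:R^-1 + simplex_shift x l * (euclid x / simplex_gauge x).

Let k1 : 0 < k.+1%:R :> R. Proof. by rewrite ltr0Sn. Qed.
Let k1i : 0 < k.+1%:R^-1 :> R. Proof. by rewrite invr_gt0. Qed.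

Lemma simplex_shift_sum x : \sum_l simplex_shift x l = 0.
Proof.
rewrite (bigD1_ord ord_max)//= /simplex_shift unlift_none.
by under eq_bigr do rewrite liftK; rewrite addNr.
Qed.

Lemma simplex_shift_lift x i : simplex_shift x (lift ord_max i) = x ord0 i.
Proof. by rewrite /simplex_shift liftK. Qed.

Lemma simplex_shiftZ (a : R) x l :
  simplex_shift (a *: x) l = a * simplex_shift x l.
Proof.
rewrite /simplex_shift; case: unlift => [i|]; first by rewrite mxE.
by rewrite mulrN mulr_sumr; under eq_bigr do rewrite mxE.
Qed.

Lemma simplex_shift_inj x y : simplex_shift x =1 simplex_shift y -> x = y.
Proof.
move=> xy; apply/rowP => i; have := xy (lift ord_max i).
by rewrite !simplex_shift_lift.
Qed.

Lemma simplex_shift0 l : simplex_shift 0 l = 0.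
Proof. by rewrite -(scale0r 0) simplex_shiftZ mul0r. Qed.

Lemma euclid_ge0 x : 0 <= euclid x. Proof. exact: sqrtr_ge0. Qed.

Lemma sum_sqr_ge0 x : 0 <= \sum_i x ord0 i ^+ 2.
Proof. by apply: sumr_ge0 => i _; exact: sqr_ge0. Qed.

Lemma euclid_eq0 x : (euclid x == 0) = (x == 0).
Proof.
rewrite /euclid sqrtr_eq0; apply/idP/eqP => [h|->]; last first.
  by rewrite big1// => i _; rewrite mxE expr0n.
have /eqP : \sum_i x ord0 i ^+ 2 = 0 by apply/eqP; rewrite eq_le h sum_sqr_ge0.
rewrite psumr_eq0 => [/allP h0|i _]; last exact: sqr_ge0.
apply/rowP => i; rewrite mxE; have := h0 i; rewrite mem_index_enum sqrf_eq0.
by move=> /(_ isT)/eqP.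
Qed.

Lemma euclid0 : euclid 0 = 0.
Proof. by apply/eqP; rewrite euclid_eq0. Qed.

Lemma euclidZ (a : R) x : 0 <= a -> euclid (a *: x) = a * euclid x.
Proof.
move=> a0; rewrite /euclid.
under eq_bigr do rewrite mxE exprMn.
by rewrite -mulr_sumr sqrtrM ?sqr_ge0// sqrtr_sqr ger0_norm.
Qed.

Lemma disk_euclid x : @disk R k x <-> euclid x <= 1.
Proof.
rewrite /disk /euclid -[X in _ <-> _ <= X]sqrtr1.
by rewrite ler_psqrt ?nnegrE ?sum_sqr_ge0.
Qed.

Lemma sphere_euclid x : @sphere R k x <-> euclid x = 1.
Proof.
rewrite /sphere/= /euclid; split=> [->|h]; first exact: sqrtr1.
by rewrite -(sqr_sqrtr (sum_sqr_ge0 x)) h expr1n.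
Qed.

Lemma simplex_gaugeZ (a : R) x : 0 <= a ->
  simplex_gauge (a *: x) = a * simplex_gauge x.
Proof.
move=> a0; rewrite /simplex_gauge mulrCA; congr (_ * _).
elim/big_rec2 : _ => [|l u v _ ->]; first by rewrite mulr0.
by rewrite simplex_shiftZ -mulrN maxr_pMr.
Qed.

Lemma simplex_gauge_ge x l :
  - simplex_shift x l <= k.+1%:R^-1 * simplex_gauge x.
Proof. by rewrite mulrA mulVf ?gt_eqF// mul1r; exact: le_bigmax. Qed.

Lemma simplex_gauge_ge0 x : 0 <= simplex_gauge x.
Proof. by rewrite mulr_ge0// bigmax_ge_id. Qed.

(** The maximum in the gauge starts from 0, which need not be a value of the
family; but if the maximum is 0, all values are, since their sum is 0. *)
Lemma simplex_gauge_attained x :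
  exists l, - simplex_shift x l = k.+1%:R^-1 * simplex_gauge x.
Proof.
have E : k.+1%:R^-1 * simplex_gauge x = \big[Num.max/0]_l - simplex_shift x l.
  by rewrite mulrA mulVf ?gt_eqF// mul1r.
have : \big[Num.max/0]_l - simplex_shift x l = 0 \/
    exists l, \big[Num.max/0]_l - simplex_shift x l = - simplex_shift x l.
  elim/big_ind : _ => [|u v hu hv|l _]; [by left| |by right; exists l].
  by rewrite maxEle; case: ifP.
rewrite E => -[m0|[l ->]]; last by exists l.
have le0 l : 0 <= simplex_shift x l.
  by rewrite -oppr_le0 -m0; exact: le_bigmax.
exists ord0; rewrite m0; apply/eqP; rewrite oppr_eq0.
have /eqP := simplex_shift_sum x.
rewrite psumr_eq0// => /allP h; apply: h; exact: mem_index_enum.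
Qed.

(** Positive coordinates are controlled by the negative ones since they sum to 0.
This makes [barycentric] continuous at the origin. *)
Lemma simplex_shift_norm x l : `|simplex_shift x l| <= simplex_gauge x.
Proof.
have g0 := simplex_gauge_ge0 x.
have h j := simplex_gauge_ge x j.
rewrite ler_norml; apply/andP; split.
  rewrite lerNl; apply: le_trans (h l) _.
  by rewrite ler_piMl// invf_le1// ler1n.
have := simplex_shift_sum x; rewrite (bigD1 l)//= => /eqP.
rewrite addr_eq0 -sumrN => /eqP ->.
apply: (@le_trans _ _ (\sum_(j < k.+1) k.+1%:R^-1 * simplex_gauge x)).
  rewrite [leRHS](bigD1 l)//= -[leLHS]add0r lerD//.
    by rewrite mulr_ge0// ltW.
  by apply: ler_sum.
by rewrite sumr_const card_ord -[leLHS]mulr_natl mulrA mulfV ?gt_eqF// mul1r.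
Qed.

Lemma simplex_gauge_gt0 x : x != 0 -> 0 < simplex_gauge x.
Proof.
move=> x0; rewrite lt_neqAle simplex_gauge_ge0 andbT; apply/eqP => g0.
case/eqP: x0; apply: simplex_shift_inj => l; rewrite simplex_shift0.
by have := simplex_shift_norm x l; rewrite -g0 normr_le0 => /eqP.
Qed.

Lemma barycentric0 l : barycentric 0 l = k.+1%:R^-1.
Proof. by rewrite /barycentric simplex_shift0 mul0r addr0. Qed.

Lemma barycentric_sum x : \sum_l barycentric x l = 1.
Proof.
rewrite big_split/= -mulr_suml simplex_shift_sum mul0r addr0.
by rewrite sumr_const card_ord -[LHS]mulr_natl mulfV// gt_eqF.
Qed.

Lemma euclid_gauge_ge0 x : 0 <= euclid x / simplex_gauge x.
Proof. by rewrite divr_ge0 ?euclid_ge0 ?simplex_gauge_ge0. Qed.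

Lemma gauge_cancel x :
  simplex_gauge x * (euclid x / simplex_gauge x) = euclid x.
Proof.
have [->|x0] := eqVneq x 0.
  by rewrite euclid0 mul0r mulr0.
by rewrite mulrC divfK// gt_eqF// simplex_gauge_gt0.
Qed.

(** With [barycentric_min], this says that the smallest coordinate is
[(1 - euclid x) / (k + 1)]: it is positive inside the disk and 0 on the sphere,
and it determines the Euclidean norm. *)
Lemma barycentric_ge x l : k.+1%:R^-1 * (1 - euclid x) <= barycentric x l.
Proof.
rewrite /barycentric mulrBr mulr1 lerD2l lerNl -mulNr.
rewrite -[in leRHS](gauge_cancel x) [leRHS]mulrA.
by rewrite ler_wpM2r ?euclid_gauge_ge0// simplex_gauge_ge.
Qed.

Lemma barycentric_min x :
  exists l, barycentric x l = k.+1%:R^-1 * (1 - euclid x).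
Proof.
have [l /eqP] := simplex_gauge_attained x.
rewrite eqr_oppLR => /eqP lE; exists l.
rewrite /barycentric mulrBr mulr1 lE; congr (_ + _).
by rewrite mulNr -mulrA gauge_cancel.
Qed.

Lemma barycentric_ge0 x l : @disk R k x -> 0 <= barycentric x l.
Proof.
move=> /disk_euclid x1; apply: le_trans (barycentric_ge x l).
by rewrite mulr_ge0// ?subr_ge0// ltW.
Qed.

Lemma barycentric_gt0 x l :
  @disk R k x -> ~ @sphere R k x -> 0 < barycentric x l.
Proof.
move=> /disk_euclid x1 /sphere_euclid/eqP xn1.
apply: lt_le_trans (barycentric_ge x l).
by rewrite mulr_gt0// ?subr_gt0// lt_neqAle xn1.
Qed.

Lemma barycentric_sphere x : @sphere R k x -> exists l, barycentric x l = 0.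
Proof.
move=> /sphere_euclid x1; have [l lE] := barycentric_min x.
by exists l; rewrite lE x1 subrr mulr0.
Qed.

Lemma barycentric_inj x y : barycentric x =1 barycentric y -> x = y.
Proof.
move=> xy.
have exy : euclid x = euclid y.
  have [i iE] := barycentric_min x; have [j jE] := barycentric_min y.
  have := barycentric_ge x j; rewrite xy jE ler_pM2l// => h1.
  have := barycentric_ge y i; rewrite -xy iE ler_pM2l// => h2.
  by apply/eqP; rewrite eq_le; apply/andP; split; lra.
(* the norms agree, and comparing the shifts shows that x and y are on one ray *)
have [x0|x0] := eqVneq x 0.
  by move: exy; rewrite x0 euclid0 => /esym/eqP; rewrite euclid_eq0 => /eqP.
have y0 : y != 0 by rewrite -euclid_eq0 -exy euclid_eq0.
have [gx gy] := (simplex_gauge_gt0 x0, simplex_gauge_gt0 y0).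
have ex0 : 0 < euclid x by rewrite lt_neqAle euclid_ge0 eq_sym euclid_eq0 x0.
pose a := simplex_gauge x / simplex_gauge y.
have a0 : 0 < a by rewrite divr_gt0.
have xE : x = a *: y.
  apply: simplex_shift_inj => l; rewrite simplex_shiftZ.
  have := xy l; rewrite /barycentric -exy => /addrI h.
  apply: (mulIf (lt0r_neq0 (divr_gt0 ex0 gx))); rewrite h /a.
  have [gx0 gy0] := (lt0r_neq0 gx, lt0r_neq0 gy).
  by rewrite mulrAC mulrA mulrC; field; rewrite gx0.
have : euclid x = a * euclid x by rewrite {1}xE euclidZ ?ltW// exy.
rewrite -{1}[euclid x]mul1r => /(mulIf (lt0r_neq0 ex0)) a1.
by rewrite xE -a1 scale1r.
Qed.

Lemma barycentric_surj t : (forall l, 0 <= t l) -> \sum_l t l = 1 ->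
  exists2 x, @disk R k x & barycentric x =1 t.
Proof.
move=> t0 t1; pose b : R := k.+1%:R^-1.
pose u : 'rV[R]_k := \row_i (t (lift ord_max i) - b).
have uE l : simplex_shift u l = t l - b.
  have h i : simplex_shift u (lift ord_max i) = t (lift ord_max i) - b.
    by rewrite simplex_shift_lift mxE.
  case: (unliftP ord_max l) => [i ->//|->].
  have := simplex_shift_sum u; rewrite (bigD1_ord ord_max)//=.
  move/eqP; rewrite addr_eq0 => /eqP ->.
  under eq_bigr do rewrite h.
  move: t1; rewrite (bigD1_ord ord_max)//= => t1.
  rewrite sumrB sumr_const card_ord -[b *+ k]mulr_natl.
  have -> : k%:R * b = 1 - b.
    by rewrite /b -[k%:R](addrK 1) natr1 mulrBl mulfV ?gt_eqF// mul1r.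
  lra.
have [u0|u0] := eqVneq u 0.
  exists 0; first by apply/disk_euclid; rewrite euclid0.
  move=> l; rewrite barycentric0; have := uE l.
  rewrite u0 simplex_shift0 -/b; lra.
have gu := simplex_gauge_gt0 u0.
have eu : 0 < euclid u by rewrite lt_neqAle euclid_ge0 eq_sym euclid_eq0 u0.
have gu1 : simplex_gauge u <= 1.
  have [l lE] := simplex_gauge_attained u.
  have : b * simplex_gauge u <= b * 1.
    by rewrite mulr1 -lE uE opprB lerBlDr lerDl.
  by rewrite ler_pM2l.
have a0 : 0 < simplex_gauge u / euclid u by rewrite divr_gt0.
exists ((simplex_gauge u / euclid u) *: u).
  by apply/disk_euclid; rewrite (euclidZ _ (ltW a0)) divfK ?gt_eqF.
move=> l; rewrite /barycentric simplex_shiftZ.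
rewrite euclidZ ?ltW// simplex_gaugeZ ?ltW// uE.
rewrite -/b; field.
by rewrite !gt_eqF.
Qed.

Lemma simplex_shift_continuous l : continuous (simplex_shift ^~ l).
Proof.
rewrite /simplex_shift; case: unlift => [i|]; first exact: coord_continuous.
have c : continuous (fun x => \sum_i x ord0 i).
  apply: continuous_big => [|i _]; first exact: add_continuous.
  exact: coord_continuous.
by move=> x; apply: continuousN; exact: c.
Qed.

Lemma euclid_continuous : continuous euclid.
Proof.
move=> x.
apply: (@continuous_comp _ _ _ (fun x : 'rV[R]_k => \sum_i x ord0 i ^+ 2));
  last exact: sqrt_continuous.
apply: continuous_big => [|i _ y]; first exact: add_continuous.
apply: (@continuous_comp _ _ _ (fun y : 'rV[R]_k => y ord0 i)
  (fun z => z ^+ 2)).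
  exact: coord_continuous.
exact: exprn_continuous.
Qed.

Lemma simplex_gauge_continuous : continuous simplex_gauge.
Proof.
have c s : continuous (fun x => \big[Num.max/0]_(l <- s) - simplex_shift x l).
  elim: s => [|l s IH] x.
    have -> : (fun x => \big[Num.max/0]_(l <- [::]) - simplex_shift x l) =
        fun=> 0.
      by apply/funext => y; rewrite big_nil.
    exact: cst_continuous.
  have -> : (fun x => \big[Num.max/0]_(l <- l :: s) - simplex_shift x l) =
      (fun x => - simplex_shift x l) \max
      (fun x => \big[Num.max/0]_(l <- s) - simplex_shift x l).
    by apply/funext => y; rewrite big_cons.
  apply: continuous_max; last exact: IH.
  by apply: continuousN; exact: simplex_shift_continuous.
move=> x.
apply: (@continuousM R _ (fun=> k.+1%:R)
  (fun x => \big[Num.max/0]_l - simplex_shift x l)).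
  exact: cst_continuous.
exact: c.
Qed.

Lemma barycentric_continuous l : continuous (barycentric ^~ l).
Proof.
move=> x; have nF := nbhs_filter x; have [x0|x0] := eqVneq x 0.
  rewrite x0 /continuous_at barycentric0; rewrite x0 in nF.
  apply/cvgrPdist_lt => e e0.
  have /cvgrPdist_lt/(_ e e0) : euclid y @[y --> (0 : 'rV[R]_k)] --> euclid 0.
    exact: euclid_continuous.
  apply: filterS => y; rewrite euclid0.
  rewrite sub0r normrN ger0_norm ?euclid_ge0// => ye.
  rewrite /barycentric opprD addNKr normrN normrM (ger0_norm (euclid_gauge_ge0 y)).
  apply: le_lt_trans ye; rewrite -[leRHS](gauge_cancel y).
  by rewrite ler_wpM2r ?euclid_gauge_ge0// simplex_shift_norm.
suff c : {for x, continuous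
    (fun x : 'rV[R]_k => simplex_shift x l * (euclid x / simplex_gauge x))}.
  by apply: cvgD; [exact: cvg_cst|exact: c].
apply: continuousM; first exact: simplex_shift_continuous.
apply: continuousM; first exact: euclid_continuous.
apply: continuousV; first by rewrite gt_eqF// simplex_gauge_gt0.
exact: simplex_gauge_continuous.
Qed.

Lemma disk_closed : closed (@disk R k).
Proof.
rewrite (_ : @disk R k = euclid @^-1` [set y | y <= 1]).
  by apply: closed_comp (@closed_le _ 1) => x _; exact: euclid_continuous.
by apply/seteqP; split=> x /disk_euclid.
Qed.

Lemma disk_compact : compact (@disk R k).
Proof.
have := @rV_compact R k (fun=> `[-1, 1]%classic)
  (fun=> @segment_compact R (-1) 1).
move=> C; apply: (subclosed_compact disk_closed C).
move=> x /disk_euclid x1 i /=; rewrite in_itv/= -ler_norml.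
rewrite -(@ler_pXn2r _ 2)// ?nnegrE// expr1n real_normK ?num_real//.
apply: le_trans (_ : \sum_i x ord0 i ^+ 2 <= 1).
  rewrite (bigD1 i)//= lerDl; apply: sumr_ge0 => j _; exact: sqr_ge0.
exact/disk_euclid.
Qed.

End disk_to_simplex.

(** * Subspaces, products and coproducts *)

Section subset_topology.
Variables (T U : topologicalType) (A : set T).

Lemma closed_set_type (C : set (set_type A)) :
  closed C <-> exists2 B : set T, closed B & C = set_val @^-1` B.
Proof.
split=> [cC|[B cB ->]].
  have : open (~` C) by rewrite openC.
  move=> [W oW WE]; exists (~` W); first by rewrite closedC.
  by rewrite -preimage_setC WE setCK.
by apply: closed_comp => // x _; exact: initial_continuous.
Qed.

Lemma set_val_continuous : continuous (set_val : set_type A -> T).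
Proof. exact: initial_continuous. Qed.

Lemma continuous_into_set_type (f : U -> set_type A) :
  continuous (set_val \o f) -> continuous f.
Proof.
move=> cf; apply/continuous_closedP => C /closed_set_type[B cB ->].
by rewrite -comp_preimage; apply: closed_comp => // x _; exact: cf.
Qed.

Lemma closed_finite_cover (I : choiceType) (s : seq I) (F : I -> set T)
    (C : set T) :
  (forall x, C x <-> exists2 i, i \in s & F i x) ->
  (forall i, i \in s -> closed (F i)) -> closed C.
Proof.
move=> CE cF.
suff -> : C = \big[setU/set0]_(i <- s) F i by exact: closed_bigsetU.
rewrite -bigcup_seq; apply/seteqP; split=> x.
  by move=> /CE[i si Fx]; exists i.
by move=> [i si Fx]; apply/CE; exists i.
Qed.

End subset_topology.

Section pointwise_topology.
Variables (T : topologicalType) (I : choiceType) (K : I -> topologicalType).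

Lemma prod_coord_continuous (i : I) :
  continuous (fun f : prod_topology K => f i).
Proof. exact: (@proj_continuous I K i). Qed.

Lemma continuous_into_prod (f : T -> prod_topology K) :
  (forall i, continuous (fun x => f x i)) -> continuous f.
Proof.
move=> cf x; apply/cvg_sup => i; apply/cvg_image.
  rewrite eqEsubset; split => y //; exists (dfwith (f x) i y) => //.
  by rewrite dfwithin.
move=> A nA /=; have := cf i x A nA; rewrite /= /nbhs /= => h.
exists ((fun g : prod_topology K => g i) @^-1` A); first exact: h.
rewrite eqEsubset; split=> [_ [g gA <-]//|y Ay].
by exists (dfwith (f x) i y); rewrite /= ?dfwithin.
Qed.

End pointwise_topology.

Section orbit_coprod_topology.
Variables (G : groupType) (I : choiceType) (H : I -> set G).
Variables (B T : topologicalType).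

(** The cosets carry the discrete topology, so a coproduct of orbits is a
coproduct of copies of [B]. *)
Lemma orbit_coprod_continuousP (f : orbit_coprod H B -> T) :
  continuous f <->
  forall i (a : coset_space (H i)), continuous (fun b => f (existT _ i (a, b))).
Proof.
split=> [cf i a b|cf [i [a b]]].
  apply: (@continuous_comp _ _ _
    (fun b => existT _ i (a, b) : orbit_coprod H B)).
    apply: (@continuous_comp _ _ _ (fun b => (a, b))); last first.
      exact: existT_continuous.
    move=> N [[P Q] /= [nP nQ] PQ]; apply: filterS nQ => y Qy; apply: PQ.
    by split => //=; exact: nbhs_singleton nP.
  exact: cf.
move=> N /(cf i a b) fN.
rewrite /nbhs /= sigT_nbhsE /=.
exists ([set a], (fun b => f (existT _ i (a, b))) @^-1` N) => /=.
  by split => //; exact: discrete_set1.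
by move=> [a' b'] /= [-> h].
Qed.

End orbit_coprod_topology.

(** * Closed simplices as sets of barycentric coordinates *)

(** A simplicial complex with an action that preserves a colouring of the vertices
for which the vertices of a simplex have distinct colours. A simplex is the list
of its vertices in the order of their colours, so lists and sets of vertices
correspond, the faces are the sublists, and an element of [G] that preserves a
simplex fixes its vertices. *)
Record regular_complex (G : groupType) (V : choiceType) (act : G -> V -> V) :=
  RegularComplex {
  vertex_action : is_action act;
  color : V -> nat;
  color_act : forall g v, color (act g v) = color v;
  simplex : set (seq V);
  simplex_sorted : forall s, simplex s -> sorted (relpre color ltn) s;
  simplex_sub : forall s t, subseq t s -> simplex s -> simplex t;
  simplex_act : forall g s, simplex s -> simplex (map (act g) s) }.

Section simplices.
Variables (R : realType) (V : choiceType).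
Implicit Types (s t : seq V) (y : {ptws V -> R}).

(** Simplices are compact in the topology of pointwise convergence on all vertices,
so all of them can be compared in one Hausdorff space. *)
Definition closed_simplex s : set {ptws V -> R} :=
  [set y | [/\ forall v, 0 <= y v, forall v, v \notin s -> y v = 0
    & \sum_(v <- s) y v = 1]].

Definition carrier s y := [seq v <- s | y v != 0].

Lemma closed_simplex_closed s : closed (closed_simplex s).
Proof.
have cc v : continuous (fun y : {ptws V -> R} => y v).
  exact: prod_coord_continuous.
rewrite (_ : closed_simplex s =
  (\bigcap_v [set y | 0 <= y v]) `&`
  (\bigcap_(v in [set v | v \notin s]) [set y | y v = 0]) `&`
  [set y | \sum_(v <- s) y v = 1]); last first.
  apply/seteqP; split=> y.
    by move=> [y0 ys y1]; split=> //; split=> v vs; [exact: y0|exact: ys].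
  by move=> [[y0 ys] y1]; split=> [v|v|]; [exact: y0|exact: ys|exact: y1].
apply: closedI; first apply: closedI.
- apply: closed_bigI => v _.
  apply: (@closed_comp _ _ (fun y : {ptws V -> R} => y v) [set r | 0 <= r]).
    by move=> y _; exact: cc.
  exact: closed_ge.
- apply: closed_bigI => v _.
  apply: (@closed_comp _ _ (fun y : {ptws V -> R} => y v) [set r | r = 0]).
    by move=> y _; exact: cc.
  exact: closed_eq.
- apply: (@closed_comp _ _ (fun y : {ptws V -> R} => \sum_(v <- s) y v)
    [set r | r = 1]) => [y _|]; last exact: closed_eq.
  by apply: continuous_big => [|v _]; [exact: add_continuous|exact: cc].
Qed.

Lemma closed_simplex_nil y : ~ closed_simplex [::] y.
Proof. by move=> [_ _ /eqP]; rewrite big_nil eq_sym oner_eq0. Qed.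

Lemma carrier_sub s y : subseq (carrier s y) s.
Proof. exact: filter_subseq. Qed.

Lemma carrier_simplex s y :
  closed_simplex s y -> closed_simplex (carrier s y) y.
Proof.
move=> [y0 ys y1]; split=> //.
  move=> v; rewrite mem_filter negb_and negbK => /orP[/eqP//|]; exact: ys.
rewrite big_filter -[RHS]y1 [RHS](bigID (fun v => y v != 0))/=.
rewrite [X in _ = _ + X]big1 ?addr0// => v; by rewrite negbK => /eqP.
Qed.

Lemma closed_simplexW s t y : uniq t -> subseq s t ->
  closed_simplex s y -> closed_simplex t y.
Proof.
move=> ut st [y0 ys y1]; split=> //.
  by move=> v vt; apply: ys; apply: contra vt; exact: (mem_subseq st).
rewrite -[RHS]y1 (bigID (fun v => v \in s))/=.
rewrite [X in _ + X]big1 ?addr0; last first.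
  by move=> v /ys.
rewrite -big_filter; congr bigop.body.
by rewrite -(subseq_uniqP ut st).
Qed.

Definition simplex_map k (s : k.+1.-tuple V) (x : 'rV[R]_k) : {ptws V -> R} :=
  fun v => \sum_l barycentric x l * (tnth s l == v)%:R.

Lemma simplex_map_continuous k (s : k.+1.-tuple V) : continuous (simplex_map s).
Proof.
apply: continuous_into_prod => v; apply: continuous_big => [|l _ x].
  exact: add_continuous.
apply: (@continuousM R _ (fun x => barycentric x l) (fun=> (tnth s l == v)%:R)).
  exact: barycentric_continuous.
exact: cst_continuous.
Qed.

Section one_simplex.
Variables (k : nat) (s : k.+1.-tuple V).
Hypothesis us : uniq s.

Lemma simplex_map_nth x l : simplex_map s x (tnth s l) = barycentric x l.
Proof.
rewrite /simplex_map (bigD1 l)//= eqxx mulr1 big1 ?addr0// => j jl.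
by rewrite (inj_eq (tuple_uniqP _ us)) (negbTE jl) mulr0.
Qed.

Lemma simplex_map_out x v : v \notin s -> simplex_map s x v = 0.
Proof.
move=> vs; rewrite /simplex_map big1// => l _.
by case: eqP => [E|_]; rewrite ?mulr0//; move: vs; rewrite -E mem_tnth.
Qed.

Lemma simplex_map_in x : @disk R k x -> closed_simplex s (simplex_map s x).
Proof.
move=> dx; split.
- move=> v; apply: sumr_ge0 => l _; rewrite mulr_ge0//.
  exact: barycentric_ge0.
- exact: simplex_map_out.
- rewrite big_tuple -[RHS](barycentric_sum x); apply: eq_bigr => l _.
  exact: simplex_map_nth.
Qed.

Lemma simplex_map_inj : injective (simplex_map s).
Proof.
by move=> x y xy; apply: barycentric_inj => l; rewrite -!simplex_map_nth xy.
Qed.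

Lemma simplex_map_onto y : closed_simplex s y ->
  exists2 x, @disk R k x & simplex_map s x = y.
Proof.
move=> [y0 ys y1].
have [|x dx xy] := @barycentric_surj R k
  (fun l => y (tnth s l)) (fun l => y0 _).
  by rewrite -[RHS]y1 big_tuple.
exists x => //; apply/funext => v.
have [/tnthP[l ->]|vs] := boolP (v \in (s : seq V)).
  by rewrite simplex_map_nth xy.
by rewrite simplex_map_out// ys.
Qed.

Lemma simplex_map_sphere x : @sphere R k x ->
  exists t : seq V,
    [/\ subseq t s, (size t <= k)%N & closed_simplex t (simplex_map s x)].
Proof.
move=> sx; exists (carrier s (simplex_map s x)); split.
- exact: carrier_sub.
- have [l xl] := barycentric_sphere sx.
  rewrite -ltnS -[X in (_ < X)%N](size_tuple s) size_filter.
  rewrite ltn_neqAle count_size andbT.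
  rewrite -all_count; apply/negP => /allP/(_ (tnth s l)).
  by rewrite mem_tnth simplex_map_nth xl eqxx => /(_ isT).
- by apply/carrier_simplex/simplex_map_in/sphere_disk.
Qed.

Lemma simplex_map_interior x : @disk R k x -> ~ @sphere R k x ->
  carrier s (simplex_map s x) = s.
Proof.
move=> dx sx; apply/all_filterP/allP => v /tnthP[l ->].
by rewrite simplex_map_nth gt_eqF// barycentric_gt0.
Qed.

(** The disk is compact, so the characteristic map of a simplex is a quotient map:
closedness in a simplex can be tested on the disk. *)
Lemma simplex_map_closed (C : set 'rV[R]_k) : closed C ->
  closed (simplex_map s @` (C `&` @disk R k)).
Proof.
move=> cC; apply: compact_closed.
  exact: (@hausdorff_product V (fun=> R) (fun=> @Rhausdorff R)).
apply: continuous_compact.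
  by apply: continuous_subspaceT; exact: simplex_map_continuous.
apply: (subclosed_compact _ (@disk_compact R k)); last by move=> x [].
by apply: closedI => //; exact: disk_closed.
Qed.

End one_simplex.
End simplices.

(** * The realization of a complex *)

Section realization.
Variables (R : realType) (G : groupType) (V : choiceType) (act : G -> V -> V).
Variable K : regular_complex act.
Implicit Types (s t : seq V) (g : G).

Definition realization_set : set {ptws V -> R} :=
  [set y | exists2 s, simplex K s & closed_simplex s y].

Definition realization : Type := set_type realization_set.

HB.instance Definition _ := Choice.copy realization (set_type realization_set).

(** The weak topology, coherent with the closed simplices. *)
Definition weakly_closed (C : set realization) := forall s, simplex K s ->
  closed (closed_simplex s `&` (val : realization -> {ptws V -> R}) @` C).

Definition weakly_open (U : set realization) := weakly_closed (~` U).

Let val_inj_r : injective (val : realization -> {ptws V -> R}).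
Proof. exact: val_inj. Qed.

Let weakly_openT : weakly_open setT.
Proof. by move=> s Ks; rewrite setCT image_set0 setI0; exact: closed0. Qed.

Let weakly_openI : setI_closed weakly_open.
Proof.
move=> A B oA oB s Ks; rewrite setCI image_setU setIUr.
by apply: closedU; [exact: oA|exact: oB].
Qed.

Let weakly_open_bigU (I : Type) (f : I -> set realization) :
  (forall i, weakly_open (f i)) -> weakly_open (\bigcup_i f i).
Proof.
move=> of_ s Ks.
rewrite (_ : _ `&` _ = closed_simplex s `&` \bigcap_i
    (closed_simplex s `&` (val : realization -> {ptws V -> R}) @` (~` f i))).
  apply: closedI; first exact: closed_simplex_closed.
  by apply: closed_bigI => i _; exact: of_.
apply/seteqP; split=> y.
  move=> [sy [z nz zy]]; split=> // i _; split=> //.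
  by exists z => // fz; apply: nz; exists i.
move=> [sy h]; split=> //.
have Ky : y \in realization_set by apply/mem_set; exists s.
exists (exist _ y Ky) => // -[i _ fi]; have [_ [z nz zy]] := h i Logic.I.
by apply: nz; rewrite (_ : z = exist _ y Ky)//; exact: val_inj_r.
Qed.

HB.instance Definition _ := isOpenTopological.Build realization
  weakly_openT weakly_openI weakly_open_bigU.

Definition coords (y : realization) : {ptws V -> R} := val y.

Lemma coords_inj : injective coords. Proof. exact: val_inj_r. Qed.

Lemma coordsP (y : realization) :
  exists2 s, simplex K s & closed_simplex s (coords y).
Proof. exact: (set_mem (valP y)). Qed.

Lemma closed_realization (C : set realization) : closed C <->
  forall s, simplex K s -> closed (closed_simplex s `&` coords @` C).
Proof.
rewrite -openC /open/= /weakly_open setCK; split=> h s; exact: h.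
Qed.

Definition realization_point y (Ky : realization_set y) : realization :=
  exist _ y (mem_set Ky).

Lemma simplex_uniq s : simplex K s -> uniq s.
Proof.
move=> /(simplex_sorted (r := K)); apply: sorted_uniq.
  by move=> u v w; exact: ltn_trans.
by move=> u; exact: ltnn.
Qed.

(** A sorted list is determined by its members, and the members of the carrier are
the vertices at which the point has a nonzero coordinate. *)
Lemma carrier_unique s t (y : {ptws V -> R}) : simplex K s -> simplex K t ->
  closed_simplex s y -> closed_simplex t y -> carrier s y = carrier t y.
Proof.
move=> Ks Kt [_ sy _] [_ ty _].
apply: (@irr_sorted_eq _ (relpre (color K) ltn)).
- by move=> u v w; exact: ltn_trans.
- by move=> u; exact: ltnn.
- exact/simplex_sorted/(simplex_sub (carrier_sub s y)).
- exact/simplex_sorted/(simplex_sub (carrier_sub t y)).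
- move=> v; rewrite !mem_filter; case: eqP => //= /eqP yv.
  have vs : v \in s by apply: contraNT yv => /sy ->.
  by rewrite vs; apply/esym; apply: contraNT yv => /ty ->.
Qed.

(** Indexed by the number of vertices, one more than the dimension: the skeleton of
index 0 is empty and serves as the skeleton of dimension -1. *)
Definition skeleton m : set realization :=
  [set y | exists s,
    [/\ simplex K s, (size s <= m)%N & closed_simplex s (coords y)]].

Lemma skeleton_carrier m s y : simplex K s -> closed_simplex s (coords y) ->
  skeleton m y -> (size (carrier s (coords y)) <= m)%N.
Proof.
move=> Ks sy [t [Kt tm ty]]; rewrite (carrier_unique Ks Kt sy ty).
exact: leq_trans (size_subseq (carrier_sub _ _)) tm.
Qed.

Lemma skeletonW m m' : (m <= m')%N -> skeleton m `<=` skeleton m'.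
Proof.
by move=> mm y [s [Ks sm sy]]; exists s; split=> //; exact: leq_trans mm.
Qed.

Lemma skeleton0 : skeleton 0 = set0.
Proof.
apply/seteqP; split=> // y [s [_]]; rewrite leqn0 size_eq0 => /eqP ->.
by move=> /closed_simplex_nil.
Qed.

Lemma mem_subseq_enum s t : subseq t s ->
  t \in [seq mask (val m) s | m <- enum {: (size s).-tuple bool}].
Proof.
move=> /subseqP[m ms ->]; apply/mapP; exists (Tuple (introT eqP ms)) => //.
by rewrite mem_enum.
Qed.

(** The trace on a larger simplex is the finite union of the traces on those faces
that have at most [m] vertices. This is why the subspace topology of a skeleton
is again coherent with its simplices. *)
Lemma closed_in_skeleton m (C : set realization) : C `<=` skeleton m ->
  (forall s, simplex K s -> (size s <= m)%N ->
    closed (closed_simplex s `&` coords @` C)) -> closed C.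
Proof.
move=> Cm cC; apply/closed_realization => s Ks.
pose ts := [seq t <- [seq mask (val m) s | m <- enum {: (size s).-tuple bool}]
  | (size t <= m)%N].
have tsub t : t \in ts -> subseq t s.
  by rewrite mem_filter => /andP[_ /mapP[u _ ->]]; exact: mask_subseq.
apply: (@closed_finite_cover _ _ ts (fun t => closed_simplex t `&` coords @` C)).
  move=> y; split=> [[sy [z Cz zy]]|[t tts [ty Cy]]].
    exists (carrier s y); last by split; [exact: carrier_simplex|exists z].
    rewrite mem_filter mem_subseq_enum ?carrier_sub// andbT.
    rewrite -zy in sy *; exact: skeleton_carrier (Cm _ Cz).
  split=> //; exact: closed_simplexW (simplex_uniq Ks) (tsub _ tts) ty.
move=> t tts; apply: cC; first exact: simplex_sub (tsub _ tts) Ks.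
by move: tts; rewrite mem_filter => /andP[].
Qed.

Definition pt_act g (y : {ptws V -> R}) : {ptws V -> R} :=
  fun v => y (act g^-1%g v).

Let va := vertex_action K.

Lemma vact1 v : act 1%g v = v. Proof. exact: va.1. Qed.
Lemma vactM g h v : act (g * h)%g v = act g (act h v). Proof. exact: va.2. Qed.
Lemma vactK g : cancel (act g) (act g^-1%g).
Proof. by move=> v; rewrite -vactM mulVg vact1. Qed.
Lemma vactVK g : cancel (act g^-1%g) (act g).
Proof. by move=> v; rewrite -vactM mulgV vact1. Qed.

Lemma pt_act_closed_simplex g s y :
  closed_simplex s y -> closed_simplex (map (act g) s) (pt_act g y).
Proof.
move=> [y0 ys y1]; split=> [v|v vs|]; first exact: y0.
  apply: ys; apply: contra vs => vs; rewrite -(vactVK g v).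
  exact: map_f.
by rewrite big_map -[RHS]y1; apply: eq_bigr => v _; rewrite /pt_act vactK.
Qed.

Lemma pt_act1 y : pt_act 1%g y = y.
Proof. by apply/funext => v; rewrite /pt_act invg1 vact1. Qed.
Lemma pt_actM g h y : pt_act (g * h)%g y = pt_act g (pt_act h y).
Proof. by apply/funext => v; rewrite /pt_act invgM vactM. Qed.

Lemma pt_act_in g y : realization_set y -> realization_set (pt_act g y).
Proof.
move=> [s Ks sy]; exists (map (act g) s); first exact: simplex_act.
exact: pt_act_closed_simplex.
Qed.

Definition realization_act g (y : realization) : realization :=
  realization_point (pt_act_in g (set_mem (valP y))).

Lemma coords_act g y : coords (realization_act g y) = pt_act g (coords y).
Proof. by []. Qed.

Lemma realization_is_action : is_action realization_act.
Proof.
split=> [y|g h y]; apply: coords_inj; rewrite !coords_act ?pt_act1//.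
exact: pt_actM.
Qed.

Lemma pt_act_continuous g : continuous (pt_act g).
Proof. by apply: continuous_into_prod => v; exact: prod_coord_continuous. Qed.

Lemma realization_act_continuous g : continuous (realization_act g).
Proof.
apply/continuous_closedP => C /closed_realization cC.
apply/closed_realization => s Ks.
rewrite (_ : _ `&` _ = closed_simplex s `&` pt_act g @^-1`
    (closed_simplex (map (act g) s) `&` coords @` C)).
  apply: closedI; first exact: closed_simplex_closed.
  apply: closed_comp; first by move=> y _; exact: pt_act_continuous.
  exact/cC/simplex_act.
apply/seteqP; split=> y.
  move=> [sy [z Cz zy]]; split=> //; split; first exact: pt_act_closed_simplex.
  by exists (realization_act g z) => //; rewrite coords_act zy.
move=> [sy [_ [z Cz zy]]]; split=> //.
have Ky : realization_set y by exists s.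
exists (realization_point Ky) => //.
have zE : z = realization_act g (realization_point Ky).
  by apply: coords_inj; rewrite coords_act.
by rewrite zE in Cz.
Qed.

Lemma skeleton_act m g y : skeleton m y -> skeleton m (realization_act g y).
Proof.
move=> [s [Ks sm sy]]; exists (map (act g) s); split.
- exact: simplex_act.
- by rewrite size_map.
- exact: pt_act_closed_simplex.
Qed.

End realization.

(** * The G-CW structure *)

Section cosets.
Variables (G : groupType) (H : set G).
Hypothesis gH : group_closed [in H].
Implicit Types a b : coset_space H.

Definition coset_set a : set G := set_val (a : set_type (lcosets H)).

Definition coset_elt a : G := xget 1%g (coset_set a).

Lemma coset1 : H 1%g.
Proof. by have [/set_mem] := gH. Qed.

Lemma coset_div g h : H g -> H h -> H (g / h)%g.
Proof. by move=> Hg Hh; apply/set_mem; apply: gH.2; exact: mem_set. Qed.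

Lemma cosetV g : H g -> H g^-1%g.
Proof.
by move=> Hg; rewrite -[g^-1%g]mul1g; apply: coset_div => //; exact: coset1.
Qed.

Lemma cosetM g h : H g -> H h -> H (g * h)%g.
Proof.
by move=> Hg Hh; rewrite -[h]invgK; apply: coset_div => //; exact: cosetV.
Qed.

Lemma coset_set_inj : injective coset_set.
Proof. by move=> a b; exact: val_inj. Qed.

Lemma mem_coset_elt a : coset_set a (coset_elt a).
Proof.
rewrite /coset_elt; case: xgetP => [? _ //|].
have [g _ ga] : lcosets H (coset_set a).
  exact: (set_mem (valP (a : set_type _))).
move=> /(_ g) []; rewrite -ga; exists 1%g; [exact: coset1|exact: mulg1].
Qed.

Lemma coset_setP a g : coset_set a g -> coset_set a = ltranslate g H.
Proof.
have [h _ <-] : lcosets H (coset_set a).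
  exact: (set_mem (valP (a : set_type _))).
move=> [k Hk <-]; apply/seteqP; split=> _ [l Hl <-].
  exists (k^-1 * l)%g; last by rewrite mulgA mulgK.
  by apply: cosetM => //; exact: cosetV.
by exists (k * l)%g; [exact: cosetM|rewrite mulgA].
Qed.

Lemma coset_elt_eq a b : H ((coset_elt a)^-1 * coset_elt b)%g -> a = b.
Proof.
move=> Hab; apply: coset_set_inj; rewrite (coset_setP (mem_coset_elt b)).
apply: coset_setP; rewrite (coset_setP (mem_coset_elt a)).
by exists ((coset_elt a)^-1 * coset_elt b)%g => //; rewrite mulgA mulgV mul1g.
Qed.

Lemma coset_set_act g a : coset_set (coset_act g a) = ltranslate g (coset_set a).
Proof. by []. Qed.

Lemma coset_elt_act g a :
  exists2 h, H h & coset_elt (coset_act g a) = (g * coset_elt a * h)%g.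
Proof.
have ga : coset_set (coset_act g a) (g * coset_elt a)%g.
  by rewrite coset_set_act; exists (coset_elt a) => //; exact: mem_coset_elt.
have := mem_coset_elt (coset_act g a); rewrite (coset_setP ga) => -[h Hh hE].
by exists h.
Qed.

Lemma coset_of_exists g : exists a, exists2 h, H h & coset_elt a = (g * h)%g.
Proof.
have Hg : ltranslate g H \in lcosets H by apply/mem_set; exists g.
pose a : coset_space H := exist _ (ltranslate g H) Hg.
by exists a; have [h Hh hE] := mem_coset_elt a; exists h.
Qed.

End cosets.

Section cw_structure.
Variables (R : realType) (G : groupType) (V : choiceType) (act : G -> V -> V).
Variable K : regular_complex act.
Local Notation Y := (realization R K).
Local Notation skel := (fun m => skeleton (R := R) (K := K) m.+1).

Let va := vertex_action K.

Definition tuple_act k g (s : k.-tuple V) : k.-tuple V := map_tuple (act g) s.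

Lemma tuple_act1 k (s : k.-tuple V) : tuple_act 1%g s = s.
Proof.
apply: val_inj => /=; rewrite -[RHS]map_id; apply: eq_map => v; exact: va.1.
Qed.

Lemma tuple_actM k g h (s : k.-tuple V) :
  tuple_act (g * h)%g s = tuple_act g (tuple_act h s).
Proof.
apply: val_inj => /=; rewrite -map_comp; apply: eq_map => v; exact: va.2.
Qed.

Definition tuple_orbit k (s : k.-tuple V) :=
  [set t | exists g, t = tuple_act g s].

(** The default [s] lies in its own orbit, so the value depends on the orbit only. *)
Definition orbit_rep k (s : k.-tuple V) := xget s (tuple_orbit s).

Lemma orbit_repP k (s : k.-tuple V) : exists g, orbit_rep s = tuple_act g s.
Proof.
rewrite /orbit_rep; case: xgetP => [_ _ //|/(_ s)[]].
by exists 1%g; rewrite tuple_act1.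
Qed.

Lemma xget_default (T : choiceType) (P : set T) x y z :
  P z -> xget x P = xget y P.
Proof.
move=> Pz; rewrite /xget; case: pselect => // -[]; exists z; exact/asboolP.
Qed.

Lemma orbit_rep_act k g (s : k.-tuple V) : orbit_rep (tuple_act g s) = orbit_rep s.
Proof.
rewrite /orbit_rep.
have -> : tuple_orbit (tuple_act g s) = tuple_orbit s.
  apply/seteqP; split=> _ [h ->].
    by exists (h * g)%g; rewrite tuple_actM.
  by exists (h * g^-1)%g; rewrite -tuple_actM mulgVK.
by apply: (@xget_default _ _ _ _ s); exists 1%g; rewrite tuple_act1.
Qed.

(** One cell of dimension [k] for each orbit of simplices with [k + 1] vertices. *)
Definition cells k : set (k.+1.-tuple V) :=
  [set s : k.+1.-tuple V | simplex K s /\ orbit_rep s = s].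

Definition cell_type k : choiceType := set_type (@cells k).

Definition cell_tuple k (i : cell_type k) : k.+1.-tuple V := val i.

Definition cell_isotropy k (i : cell_type k) : set G :=
  [set g | tuple_act g (cell_tuple i) = cell_tuple i].

Lemma cell_isotropy_group k (i : cell_type k) : group_closed [in cell_isotropy i].
Proof.
split=> [|g h /set_mem gi /set_mem hi]; apply/mem_set; first exact: tuple_act1.
have hVi : tuple_act h^-1%g (cell_tuple i) = cell_tuple i.
  by rewrite -{1}hi -tuple_actM mulVg tuple_act1.
by rewrite /cell_isotropy /= tuple_actM hVi.
Qed.

Local Notation cells_on k B := (orbit_coprod (@cell_isotropy k) B).

Definition cell_at k (i : cell_type k) (a : coset_space (cell_isotropy i)) :
  k.+1.-tuple V := tuple_act (coset_elt a) (cell_tuple i).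

Lemma cell_at_simplex k i a : simplex K (@cell_at k i a).
Proof. by apply: simplex_act; have [] := set_mem (valP i). Qed.

Lemma cell_at_uniq k i a : uniq (@cell_at k i a).
Proof. exact: simplex_uniq (cell_at_simplex _). Qed.

Lemma cell_at_act k g i a :
  @cell_at k i (coset_act g a) = tuple_act g (cell_at a).
Proof.
have [h hi aE] := coset_elt_act (cell_isotropy_group i) g a.
by rewrite /cell_at aE !tuple_actM hi.
Qed.

Lemma cell_at_onto k (s : k.+1.-tuple V) : simplex K s ->
  exists i (a : coset_space (cell_isotropy i)), @cell_at k i a = s.
Proof.
move=> Ks; have [g gs] := orbit_repP s.
have rs : cells (orbit_rep s).
  split; last by rewrite {1}gs orbit_rep_act.
  by rewrite gs; apply: simplex_act.
pose i : cell_type k := exist _ (orbit_rep s) (mem_set rs).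
have [a [h hi aE]] := coset_of_exists (cell_isotropy_group i) g^-1%g.
exists i, a; rewrite /cell_at aE tuple_actM hi.
by rewrite /cell_tuple/= gs -tuple_actM mulVg tuple_act1.
Qed.

(** With [cell_at_onto], pairs of a cell and a coset of its isotropy group
correspond to the simplices of dimension [k]. *)
Lemma cell_at_inj k i j a b : @cell_at k i a = @cell_at k j b ->
  existT (fun i => coset_space (cell_isotropy i)) i a = existT _ j b.
Proof.
move=> ab; have ij : i = j.
  apply: val_inj.
  have [_ <-] := set_mem (valP i); have [_ <-] := set_mem (valP j).
  by have := congr1 (@orbit_rep _) ab; rewrite /cell_at !orbit_rep_act.
case: _ / ij b ab => b ab; congr existT.
apply: (coset_elt_eq (cell_isotropy_group i)).
rewrite /cell_isotropy/= tuple_actM -[tuple_act (coset_elt b) _]ab.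
by rewrite /cell_at -tuple_actM mulVg tuple_act1.
Qed.

Definition charac_coords k (p : cells_on k (set_type (@disk R k))) :
    {ptws V -> R} :=
  simplex_map (cell_at (projT2 p).1) (set_val (projT2 p).2).

Lemma charac_closed_simplex k (p : cells_on k (set_type (@disk R k))) :
  closed_simplex (cell_at (projT2 p).1) (charac_coords p).
Proof. by apply: simplex_map_in; [exact: cell_at_uniq|exact: set_valP]. Qed.

Lemma charac_realization k (p : cells_on k (set_type (@disk R k))) :
  realization_set K (charac_coords p).
Proof.
exists (cell_at (projT2 p).1); first exact: cell_at_simplex.
exact: charac_closed_simplex.
Qed.

Definition charac_point k (p : cells_on k (set_type (@disk R k))) : Y :=
  realization_point (charac_realization p).

Lemma charac_skel k (p : cells_on k (set_type (@disk R k))) :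
  skel k (charac_point p).
Proof.
exists (cell_at (projT2 p).1); split; first exact: cell_at_simplex.
  by rewrite size_tuple.
exact: charac_closed_simplex.
Qed.

Definition sphere_incl k := subset_incl (@sphere_disk R k).

Lemma pskelE k : pskel skel k = skeleton k.
Proof. by case: k => //=; rewrite skeleton0. Qed.

Lemma attach_pskel k (p : cells_on k (set_type (@sphere R k))) :
  pskel skel k (charac_point (orbit_coprod_map (@sphere_incl k) p)).
Proof.
rewrite pskelE.
have [t [ts tk tp]] :=
  simplex_map_sphere (cell_at_uniq (projT2 p).1) (set_valP (projT2 p).2).
exists t; split=> //; first exact: simplex_sub ts (cell_at_simplex _).
Qed.

Definition cell_charac k (p : cells_on k (set_type (@disk R k))) :
    set_type (skel k) :=
  exist _ (charac_point p) (mem_set (charac_skel p)).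

Definition cell_attach k (p : cells_on k (set_type (@sphere R k))) :
    set_type (pskel skel k) :=
  exist _ (charac_point (orbit_coprod_map (@sphere_incl k) p))
    (mem_set (attach_pskel p)).

Lemma simplex_map_act k g (s : k.+1.-tuple V) (x : 'rV[R]_k) :
  simplex_map (tuple_act g s) x = pt_act act g (simplex_map s x).
Proof.
apply/funext => v; apply: eq_bigr => l _; rewrite tnth_map.
congr (_ * (nat_of_bool _)%:R); apply/eqP/eqP => [<-|->].
  by rewrite (vactK K).
by rewrite (vactVK K).
Qed.

Lemma charac_point_act k g (p : cells_on k (set_type (@disk R k))) :
  charac_point (orbit_coprod_act g p) = realization_act g (charac_point p).
Proof.
apply: coords_inj; rewrite coords_act.
exact: etrans (congr1 (fun s => simplex_map s (set_val (projT2 p).2))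
  (cell_at_act g _)) (simplex_map_act g _ _).
Qed.

Lemma charac_point_continuous k : continuous (@charac_point k).
Proof.
apply/orbit_coprod_continuousP => i a; apply/continuous_closedP => C.
move=> /closed_realization/(_ _ (cell_at_simplex a)) cC.
rewrite (_ : _ @^-1` C = (fun b : set_type (@disk R k) =>
    simplex_map (cell_at a) (set_val b)) @^-1`
    (closed_simplex (cell_at a) `&` @coords R G V act K @` C)).
  apply: closed_comp cC => x _.
  apply: (@continuous_comp _ _ _ (set_val : set_type (@disk R k) -> _)).
    exact: set_val_continuous.
  exact: simplex_map_continuous.
apply/seteqP; split=> x /=.
  move=> Cx; split; first exact: (charac_closed_simplex (existT _ i (a, x))).
  by exists (charac_point (existT _ i (a, x))).
by move=> [_ [z Cz zE]]; rewrite (_ : charac_point _ = z)//; exact: coords_inj.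
Qed.

Lemma charac_interior k (p : cells_on k (set_type (@disk R k))) :
  ~ @sphere R k (set_val (projT2 p).2) -> ~ skeleton k (charac_point p).
Proof.
move=> nsp /(skeleton_carrier (y := charac_point p)
  (cell_at_simplex (projT2 p).1) (charac_closed_simplex p)).
rewrite [carrier _ _]simplex_map_interior//.
- by rewrite size_tuple ltnn.
- exact: cell_at_uniq.
- exact: set_valP.
Qed.

Lemma charac_boundary k (p : cells_on k (set_type (@disk R k))) :
  skeleton k (charac_point p) ->
  exists q, p = orbit_coprod_map (@sphere_incl k) q.
Proof.
case: p => i [a x] px.
have sx : @sphere R k (set_val x).
  by apply: contrapT => nsx; exact: (@charac_interior _ (existT _ i (a, x))).
exists (existT _ i (a, exist _ (set_val x) (mem_set sx))).
have {1}-> : x = sphere_incl (exist _ (set_val x) (mem_set sx)).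
  exact: val_inj.
by [].
Qed.

Lemma charac_point_inj k (p q : cells_on k (set_type (@disk R k))) :
  ~ skeleton k (charac_point p) -> charac_point p = charac_point q -> p = q.
Proof.
move=> np pq; have nq : ~ skeleton k (charac_point q) by rewrite -pq.
(* the carrier of an interior point is the whole simplex *)
have full (r : cells_on k (set_type (@disk R k))) :
    ~ skeleton k (charac_point r) ->
    carrier (cell_at (projT2 r).1) (coords (charac_point r)) =
    cell_at (projT2 r).1.
  move=> nr; apply: simplex_map_interior.
  - exact: cell_at_uniq.
  - exact: set_valP.
  move=> sr; apply: nr.
  have [t [ts tk tp]] := simplex_map_sphere (cell_at_uniq (projT2 r).1) sr.
  by exists t; split=> //; exact: simplex_sub ts (cell_at_simplex _).
have st : cell_at (projT2 p).1 = cell_at (projT2 q).1.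
  apply: val_inj; rewrite /= -(full _ np) -(full _ nq) pq.
  apply: carrier_unique; [exact: cell_at_simplex|exact: cell_at_simplex| |].
    by rewrite -pq; exact: charac_closed_simplex.
  exact: charac_closed_simplex.
have xy : set_val (projT2 p).2 = set_val (projT2 q).2.
  apply: (simplex_map_inj (cell_at_uniq (projT2 p).1)).
  have := congr1 (fun y => coords y) pq.
  rewrite [coords (charac_point q)]/(simplex_map (cell_at (projT2 q).1) _).
  by rewrite -st.
case: p q {np nq pq full} st xy => [i [a x]] [j [b y]] /= st /val_inj xy.
have := cell_at_inj st; rewrite xy => E.
exact: (congr1 (fun q => existT (fun i => (coset_space (cell_isotropy i) *
  set_type (@disk R k))%type) (projT1 q) (projT2 q, y)) E).
Qed.

Lemma charac_point_onto k y : skel k y -> ~ skeleton k y ->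
  exists p, @charac_point k p = y.
Proof.
move=> [s [Ks sk sy]] ny.
have sz : size s == k.+1.
  rewrite eqn_leq sk ltnNge; apply/negP => sk'; apply: ny; exists s; split=> //.
have [i [a aE]] := @cell_at_onto k (Tuple sz) Ks.
have [x dx xy] := @simplex_map_onto _ _ _ (Tuple sz) (simplex_uniq Ks) _ sy.
exists (existT _ i (a, exist _ x (mem_set dx))).
by apply: coords_inj; rewrite -xy -aE.
Qed.

Lemma pskel_sub k : pskel skel k `<=` skel k.
Proof. by rewrite pskelE; exact: skeletonW. Qed.

Lemma subset_incl_continuous (T : topologicalType) (A B : set T)
    (AB : A `<=` B) : continuous (subset_incl AB).
Proof. by apply: continuous_into_set_type; exact: set_val_continuous. Qed.

Lemma orbit_coprod_map_continuous k (B C : topologicalType) (f : B -> C) :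
  continuous f ->
  continuous (orbit_coprod_map f : cells_on k B -> cells_on k C).
Proof.
move=> cf; apply/orbit_coprod_continuousP => i a b.
apply: (@continuous_comp _ _ _ f (fun c => existT _ i (a, c) : cells_on k C)).
  exact: cf.
have [+ _] := orbit_coprod_continuousP (id : cells_on k C -> cells_on k C).
by apply => x; exact: cvg_id.
Qed.

(** On sets, the [k]-skeleton is the disjoint union of the previous one and of the
interiors of the cells, which determines the map [w]. For its continuity, the
preimage of a closed set is tested on the simplices with at most [k + 1] vertices
([closed_in_skeleton]): on those with fewer vertices it is governed by [u], and on
those with [k + 1] vertices by [v], through the quotient map from the disk. *)
Lemma cell_pushout k : is_pushout (@cell_attach k)
  (orbit_coprod_map (@sphere_incl k)) (subset_incl (@pskel_sub k))
  (@cell_charac k).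
Proof.
split; first split.
- apply: continuous_into_set_type => p.
  apply: (@continuous_comp _ _ _ (orbit_coprod_map (@sphere_incl k))).
    exact/orbit_coprod_map_continuous/subset_incl_continuous.
  exact: charac_point_continuous.
- exact/orbit_coprod_map_continuous/subset_incl_continuous.
- exact: subset_incl_continuous.
- by apply: continuous_into_set_type; exact: charac_point_continuous.
split; first by apply/funext => p; exact: val_inj.
move=> T u v cu cv uv.
have attachE q : v (orbit_coprod_map (@sphere_incl k) q) = u (cell_attach q).
  by rewrite -[RHS]/((u \o _) q) uv.
have inner (y : set_type (skel k)) : ~ skeleton k (set_val y) ->
    exists p, cell_charac p = y.
  move=> ny; have [p pE] := charac_point_onto (set_valP y) ny.
  by exists p; exact: val_inj.
have outer (y : set_type (skel k)) : skeleton k (set_val y) ->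
    exists b, subset_incl (@pskel_sub k) b = y.
  move=> yk; have yk' : pskel skel k (set_val y) by rewrite pskelE.
  by exists (exist _ (set_val y) (mem_set yk')); exact: val_inj.
have outerP (b : set_type (pskel skel k)) : skeleton k (set_val b).
  by rewrite -pskelE; exact: set_valP.
have /choice[w wP] : forall y, exists t,
    (forall b, subset_incl (@pskel_sub k) b = y -> u b = t) /\
    (forall p, cell_charac p = y -> v p = t).
  move=> y; have [yk|ny] := pselect (skeleton k (set_val y)).
    have [b bE] := outer y yk; exists (u b); split=> [b' b'E|p pE].
      by congr u; apply: val_inj; have := congr1 set_val (etrans b'E (esym bE)).
    have [|q pq] := @charac_boundary k p.
      by rewrite [charac_point p](congr1 set_val pE).
    rewrite pq attachE; congr u; apply: val_inj.
    have := congr1 set_val (etrans pE (esym bE)).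
    by rewrite pq.
  have [p pE] := inner y ny; exists (v p); split=> [b bE|q qE].
    by case: ny; rewrite -bE; exact: outerP.
  congr v; apply: charac_point_inj.
    by rewrite [charac_point q](congr1 set_val qE).
  have : set_val (cell_charac q) = set_val (cell_charac p) by rewrite qE pE.
  by [].
have wu b : w (subset_incl (@pskel_sub k) b) = u b.
  by have [/(_ b erefl)] := wP (subset_incl (@pskel_sub k) b).
have wv p : w (cell_charac p) = v p.
  by have [_ /(_ p erefl)] := wP (cell_charac p).
exists w; split; last first.
  move=> w' [_ w'u w'v]; apply/funext => y.
  have [/outer[b <-]|/inner[p <-]] := pselect (skeleton k (set_val y)).
    by rewrite wu -w'u.
  by rewrite wv -w'v.
split; [|exact/funext|exact/funext].
apply/continuous_closedP => Z cZ; apply/closed_set_type.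
pose C : set Y := set_val @` (w @^-1` Z).
exists C; last first.
  apply/seteqP; split=> y /=; first by exists y.
  by move=> [y' Zy' /val_inj <-].
apply: (@closed_in_skeleton _ _ _ _ K k.+1).
  by move=> _ [y _ <-]; exact: set_valP.
move=> s Ks; rewrite leq_eqVlt => /orP[/eqP sk|]; last first.
  rewrite ltnS => sk.
  have : closed (u @^-1` Z) by apply: closed_comp cZ => b _; exact: cu.
  move=> /closed_set_type[B cB BE].
  rewrite (_ : _ `&` _ = closed_simplex s `&` @coords R G V act K @` B).
    by move: s Ks {sk}; exact/closed_realization.
  have CB z : skeleton k z -> C z <-> B z.
    move=> zk; have zk' : pskel skel k z by rewrite pskelE.
    pose b : set_type (pskel skel k) := exist _ z (mem_set zk').
    have -> : B z = Z (u b) by rewrite -[RHS]/((u @^-1` Z) b) BE.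
    rewrite -wu; split=> [[y Zy yz]|Zz].
      by rewrite (_ : subset_incl _ b = y)//; exact: val_inj.
    by exists (subset_incl (@pskel_sub k) b).
  by apply/seteqP; split=> y [sy [z Dz zy]]; split=> //; exists z => //;
    apply/CB => //; exists s; rewrite zy.
have sz : size s == k.+1 by rewrite sk.
have [i [a aE]] := @cell_at_onto k (Tuple sz) Ks.
have cva : continuous (fun b => v (existT _ i (a, b))).
  by have [+ _] := orbit_coprod_continuousP v; exact.
have : closed ((fun b => v (existT _ i (a, b))) @^-1` Z).
  by apply: closed_comp cZ => b _; exact: cva.
move=> /closed_set_type[A cA AE].
rewrite (_ : _ `&` _ = simplex_map (Tuple sz) @` (A `&` @disk R k)).
  exact: simplex_map_closed.
apply/seteqP; split=> y.
  move=> [sy [z [t Zt tz] zy]].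
  have [x dx xy] := @simplex_map_onto _ _ _ (Tuple sz) (simplex_uniq Ks) _ sy.
  exists x => //; split=> //.
  pose b : set_type (@disk R k) := exist _ x (mem_set dx).
  suff : (set_val @^-1` A) b by [].
  rewrite -AE /= -wv (_ : cell_charac _ = t)//.
  apply: val_inj; apply: coords_inj.
  by rewrite /= -[RHS]/(coords (set_val t)) tz zy -xy -aE.
move=> [x [Ax dx] <-].
pose p : cells_on k (set_type (@disk R k)) :=
  existT _ i (a, exist _ x (mem_set dx)).
have pE : coords (charac_point p) = simplex_map (Tuple sz) x by rewrite -aE.
split.
  by apply: (@simplex_map_in _ _ _ (Tuple sz)) => //; exact: simplex_uniq Ks.
exists (charac_point p) => //; exists (cell_charac p) => //=.
rewrite wv.
suff : ((fun b => v (existT _ i (a, b))) @^-1` Z) (exist _ x (mem_set dx)).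
  by [].
by rewrite AE.
Qed.

Definition realization_GCW : GCW_structure R (@realization_act R G V act K).
Proof.
refine (@GCWStructure R G Y (@realization_act R G V act K)
  (@realization_is_action R G V act K)
  (@realization_act_continuous R G V act K) skel pskel_sub
  _ cell_type cell_isotropy cell_isotropy_group cell_attach cell_charac
  _ _ cell_pushout _ _).
- by move=> k g y; exact: skeleton_act.
- move=> k g p.
  exact: (charac_point_act g (orbit_coprod_map (@sphere_incl k) p)).
- by move=> k g p; exact: (charac_point_act g p).
- rewrite -subTset => y _; have [s Ks sy] := coordsP y.
  by exists (size s) => //; exists s; split=> //; exact: leqnSn.
- move=> C cC; apply/closed_realization => s Ks.
  have /closed_set_type[B cB BE] := cC (size s).
  rewrite (_ : _ `&` _ = closed_simplex s `&` @coords R G V act K @` B).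
    by have /closed_realization/(_ s Ks) := cB.
  have CB z : closed_simplex s (coords z) -> C z <-> B z.
    move=> sz; have zs : skel (size s) z by exists s; split=> //; exact: leqnSn.
    have : (set_val @^-1` C)
      (exist _ z (mem_set zs) : set_type (skel (size s))) = C z by [].
    by rewrite BE => <-.
  by apply/seteqP; split=> y [sy [z Dz zy]]; split=> //; exists z => //;
    apply/CB => //; rewrite zy.
Defined.

Lemma realization_dim n : (forall s, simplex K s -> (size s <= n.+1)%N) ->
  GCW_dim_le realization_GCW n.
Proof.
move=> Kn; rewrite /GCW_dim_le -subTset => y _.
by have [s Ks sy] := coordsP y; exists s; split=> //; exact: Kn.
Qed.

End cw_structure.

(** * Carriers and stabilizers *)

Lemma sorted_color_inj (V : eqType) (color : V -> nat) (s : seq V) u v :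
  sorted (relpre color ltn) s -> u \in s -> v \in s -> color u = color v -> u = v.
Proof.
move=> ss us vs uv.
have tr : transitive (relpre color ltn) by move=> a b c; exact: ltn_trans.
have lt := sorted_ltn_index tr ss.
have [i|i|i] := ltngtP (index u s) (index v s).
- by have := lt u v us vs i; rewrite /= uv ltnn.
- by have := lt v u vs us i; rewrite /= uv ltnn.
- by rewrite -(nth_index u us) i nth_index.
Qed.

Lemma nbhs_all (T : topologicalType) (I : eqType) (s : seq I)
    (P : I -> set T) (x : T) :
  (forall i, i \in s -> nbhs x (P i)) ->
  nbhs x [set y | forall i, i \in s -> P i y].
Proof.
elim: s => [|i s IH] Ps.
  by apply: filterS (@filterT _ (nbhs x) _) => y _ i.
have nI := Ps i (mem_head i s).
have nS : nbhs x [set y | forall i, i \in s -> P i y].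
  by apply: IH => j js; apply: Ps; rewrite inE js orbT.
apply: filterS (filterI nI nS) => y [Pi Py] j; rewrite inE => /orP[/eqP->//|].
exact: Py.
Qed.

(** An element that fixes a point permutes its carrier without changing colours,
hence fixes every vertex of the carrier. *)
Lemma realization_stabilizer (R : realType) (G : groupType) (V : choiceType)
    (act : G -> V -> V) (K : regular_complex act) (y : realization R K) :
  exists s v, [/\ simplex K s, v \in s &
    stabilizer (@realization_act R G V act K) y `<=` stabilizer act v].
Proof.
have [s Ks sy] := coordsP y.
have cs := carrier_simplex sy.
have Kc := simplex_sub (carrier_sub s (coords y)) Ks.
case E : (carrier s (coords y)) => [|v t].
  by move: cs; rewrite E => /closed_simplex_nil.
have vc : v \in carrier s (coords y) by rewrite E mem_head.
exists (carrier s (coords y)), v; split=> // g gy.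
have vK := vactVK K g v; have Kv := vactK K g.
have : act g^-1%g v = v.
  apply: (sorted_color_inj (simplex_sorted Kc)) => //; last exact: color_act.
  have yv : coords y (act g^-1%g v) = coords y v.
    by rewrite -[in RHS]gy.
  have nz : coords y v != 0 by move: vc; rewrite mem_filter => /andP[].
  have [_ sy0 _] := cs.
  by apply: contraNT nz => /sy0; rewrite yv => ->.
by move=> gV; rewrite /stabilizer /= -[in LHS]gV.
Qed.

(** * The nerve of the slices *)

Section slice_complex.
Variables (R : realType) (G : groupType) (X : metricType R) (act : G -> X -> X).
Hypotheses (aA : is_action act) (aI : isometric_action act).
Variables (c : nat -> X) (r : nat -> R) (w : nat -> X -> R).
Hypotheses (r_gt0 : forall j, 0 < r j)
  (c_isolated : forall j, isolated act (4 * r j) (c j))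
  (w_tube : forall j x, 0 < w j x -> exists g, mdist (act g (c j)) x < r j)
  (w_cont : forall j, continuous (w j))
  (w_ge0 : forall j x, 0 <= w j x)
  (w_act : forall j g x, w j (act g x) = w j x)
  (w_fin : locally_finite (fun j => [set y | 0 < w j y]))
  (w_cover : forall x, exists j, 0 < w j x).

(** The vertex [(j, z)] stands for the part of the ball of radius [r j] around the point [z]
of the orbit of [c j] on which [w j] is positive; its index is its colour. *)
Definition slice : choiceType := (nat * X)%type.

Definition slice_act g (v : slice) : slice := (v.1, act g v.2).

Definition slice_nbhd (v : slice) : set X := [set x |
  [/\ 0 < w v.1 x, mdist v.2 x < r v.1 & act_orbit act (c v.1) v.2]].

Lemma slice_is_action : is_action slice_act.
Proof.
split=> [[j z]|g h [j z]]; rewrite /slice_act/=; first by rewrite (act1 aA).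
by rewrite (actM aA).
Qed.

Lemma slice_nbhd_act g v x :
  slice_nbhd v x -> slice_nbhd (slice_act g v) (act g x).
Proof.
move=> [w0 d [h _ hE]]; split; rewrite /= ?w_act ?aI//.
by exists (g * h)%g => //; rewrite (actM aA) hE.
Qed.

Lemma slice_nbhd_actV g v x :
  slice_nbhd v (act g x) <-> slice_nbhd (slice_act g^-1%g v) x.
Proof.
split=> [/(slice_nbhd_act g^-1%g)|/(slice_nbhd_act g)]; rewrite ?(actK aA)//.
by rewrite -slice_is_action.2 mulgV slice_is_action.1.
Qed.

(** The centres would be at distance less than [4 * r j] in one orbit, hence equal
by isolation. *)
Lemma slice_separated j z z' x y : slice_nbhd (j, z) x -> slice_nbhd (j, z') y ->
  mdist x y < 2 * r j -> z = z'.
Proof.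
move=> [_ /= zx [g _ gz]] [_ /= zy [h _ hz]] xy.
have : mdist z z' < 4 * r j.
  have t1 := metric_triangle z x z'; have t2 := metric_triangle x y z'.
  rewrite (metric_sym y z') in t2; lra.
rewrite -gz -hz (mdist_actl aA aI) -(actM aA) => /c_isolated hc.
by rewrite -[in LHS]hc (actM aA) (actVK aA).
Qed.

Lemma slice_exists j x : 0 < w j x -> exists z, slice_nbhd (j, z) x.
Proof.
move=> wx; have [g gx] := w_tube wx; exists (act g (c j)); split=> //.
by exists g.
Qed.

Definition slice_simplex (s : seq slice) : Prop :=
  sorted (relpre fst ltn) s /\ exists x, forall v, v \in s -> slice_nbhd v x.

Definition slice_complex : regular_complex slice_act.
Proof.
refine (@RegularComplex G slice slice_act slice_is_action fst _
  slice_simplex _ _ _).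
- by [].
- by move=> s [].
- move=> s t ts [ss [x sx]]; split.
    by apply: subseq_sorted ts ss => a b d; exact: ltn_trans.
  by exists x => v vt; apply: sx; exact: mem_subseq ts _ vt.
- move=> g s [ss [x sx]]; split; first by rewrite sorted_map.
  by exists (act g x) => _ /mapP[v vs ->]; exact/slice_nbhd_act/sx.
Defined.

Lemma slice_simplex_size n :
  (forall x, multiplicity_le (fun j => [set y | 0 < w j y]) n x) ->
  forall s, simplex slice_complex s -> (size s <= n.+1)%N.
Proof.
move=> mw s [ss [x sx]]; rewrite leqNgt; apply/negP => sn.
have lt (i : 'I_n.+2) : (i < size s)%N by apply: leq_trans sn.
apply: (mw x (fun i => (nth (0%N, x) s i).1)).
  move=> i i' /(sorted_color_inj ss (mem_nth _ (lt i)) (mem_nth _ (lt i'))).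
  move=> /eqP.
  rewrite nth_uniq//; first by move=> /eqP; exact: val_inj.
  by apply: (simplex_uniq (K := slice_complex)); split=> //; exists x.
by move=> i; have [] := sx _ (mem_nth (0%N, x) (lt i)).
Qed.

(** Past this index all the functions vanish near [x]. *)
Let bound x : nat := sval (cid (w_fin x)).

Let boundP x : \forall y \near x, forall j, (bound x <= j)%N -> ~ 0 < w j y.
Proof. by rewrite /bound; case: cid. Qed.

Let bound0 x j : (bound x <= j)%N -> w j x = 0.
Proof.
move=> bj; have /nbhs_singleton/(_ j bj)/negP := boundP x.
by rewrite -leNgt => wle; apply/eqP; rewrite eq_le wle w_ge0.
Qed.

Definition total_weight x := \sum_(j < bound x) w j x.

Let total_weightE x N : (forall j, (N <= j)%N -> w j x = 0) ->
  total_weight x = \sum_(j < N) w j x.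
Proof.
move=> wN; rewrite /total_weight -!(big_mkord predT (fun j => w j x)).
have ext N1 N2 : (N1 <= N2)%N -> (forall j, (N1 <= j)%N -> w j x = 0) ->
    \sum_(0 <= j < N1) w j x = \sum_(0 <= j < N2) w j x.
  move=> N12 w0; rewrite (big_cat_nat (n := N1) (leq0n _) N12)//=.
  rewrite [X in _ + X]big1_seq ?addr0//.
  by move=> j /andP[_]; rewrite mem_index_iota => /andP[/w0].
have [NN|/ltnW NN] := leqP (bound x) N.
  by apply: ext => // j; exact: bound0.
by apply/esym/ext.
Qed.

Lemma total_weight_gt0 x : 0 < total_weight x.
Proof.
have [j wj] := w_cover x.
have jb : (j < bound x)%N.
  by rewrite ltnNge; apply/negP => /bound0 w0; rewrite w0 ltxx in wj.
rewrite /total_weight (bigD1 (Ordinal jb))//=; apply: ltr_wpDr => //.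
exact: sumr_ge0.
Qed.

Lemma total_weight_act g x : total_weight (act g x) = total_weight x.
Proof.
rewrite (@total_weightE (act g x) (bound x)).
  by apply: eq_bigr => j _; rewrite w_act.
by move=> j /bound0; rewrite w_act.
Qed.

Lemma total_weight_continuous : continuous total_weight.
Proof.
move=> x; have h : {for x, continuous (fun y => \sum_(j < bound x) w j y)}.
  by apply: continuous_big => [|j _]; [exact: add_continuous|exact: w_cont].
rewrite /continuous_at /total_weight; apply: cvg_trans h.
apply: near_eq_cvg; apply: filterS (boundP x) => y yb.
apply/esym; apply: total_weightE => j /yb /negP; rewrite -leNgt => wle.
by apply/eqP; rewrite eq_le wle w_ge0.
Qed.

Definition slice_coords x : {ptws slice -> R} :=
  fun v => if `[< slice_nbhd v x >] then w v.1 x / total_weight x else 0.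

Lemma slice_coords_in x v :
  slice_nbhd v x -> slice_coords x v = w v.1 x / total_weight x.
Proof. by move=> vx; rewrite /slice_coords asboolT. Qed.

Lemma slice_coords_out x v : ~ slice_nbhd v x -> slice_coords x v = 0.
Proof. by move=> vx; rewrite /slice_coords asboolF. Qed.

Lemma slice_coords_bound x v :
  0 <= slice_coords x v <= w v.1 x / total_weight x.
Proof.
have h : 0 <= w v.1 x / total_weight x by rewrite divr_ge0// ltW// total_weight_gt0.
by rewrite /slice_coords; case: ifP; rewrite h lexx.
Qed.

(** The list [L] of candidates is arbitrary so that it can be kept fixed while [x]
varies in a neighbourhood. The sum is 1 because for each [j] with [w j x]
positive there is exactly one slice of index [j] containing [x]. *)
Lemma slice_coords_simplex (L : seq slice) x :
  sorted (relpre fst ltn) L ->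
  (forall v, slice_nbhd v x -> v \in L) ->
  let t := [seq v <- L | `[< slice_nbhd v x >]] in
  simplex slice_complex t /\ closed_simplex t (slice_coords x).
Proof.
move=> sL Lx t.
have tP v : (v \in t) = `[< slice_nbhd v x >].
  rewrite mem_filter; case: asboolP => //= vx; exact: Lx.
have st : sorted (relpre fst ltn) t.
  apply: subseq_sorted sL => [a b d|]; first exact: ltn_trans.
  exact: filter_subseq.
split; first by split=> //; exists x => v; rewrite tP => /asboolP.
split.
- by move=> v; have /andP[] := slice_coords_bound x v.
- by move=> v; rewrite tP => /asboolP/slice_coords_out.
have -> : \sum_(v <- t) slice_coords x v = \sum_(v <- t) w v.1 x / total_weight x.
  by apply: eq_big_seq => v; rewrite tP => /asboolP/slice_coords_in.
rewrite -mulr_suml -[RHS](mulfV (lt0r_neq0 (total_weight_gt0 x))).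
congr (_ / _).
rewrite -(big_map fst predT (fun j => w j x)) /total_weight.
rewrite -(big_mkord predT (fun j => w j x)).
rewrite /index_iota subn0 [RHS](bigID (fun j => 0 < w j x))/=.
rewrite [X in _ = _ + X]big1 ?addr0; last first.
  by move=> j; rewrite -leNgt => wle; apply/eqP; rewrite eq_le wle w_ge0.
rewrite -[RHS]big_filter; congr bigop.body.
apply: (irr_sorted_eq ltn_trans ltnn).
- by rewrite sorted_map.
- apply: sorted_filter; [exact: ltn_trans|exact: iota_ltn_sorted].
- move=> j; rewrite mem_filter mem_iota add0n /=; apply/mapP/andP.
    move=> [v vt ->]; move: vt; rewrite tP => /asboolP[wv _ _]; split=> //.
    by rewrite ltnNge; apply/negP => /bound0 w0; rewrite w0 ltxx in wv.
  move=> [wj _]; have [z zx] := slice_exists wj.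
  by exists (j, z) => //; rewrite tP; exact/asboolP.
Qed.

(** Only the indices below the bound matter, and for each of them a ball of radius
[r j] meets at most one slice. *)
Lemma slices_near (x : X) : exists L : seq slice, sorted (relpre fst ltn) L /\
  \forall y \near x, forall v, slice_nbhd v y -> v \in L.
Proof.
have /choice[z zP] : forall j, exists z, \forall y \near x,
    forall z', slice_nbhd (j, z') y -> z' = z.
  move=> j.
  have [[z [y [yx zy]]]|nz] :=
      pselect (exists z y, mdist x y < r j /\ slice_nbhd (j, z) y); last first.
    exists (c j); apply/nbhs_mdist; exists (r j) => // y xy z' z'y.
    by case: nz; exists z', y.
  exists z; apply/nbhs_mdist; exists (r j) => // y' xy' z' z'y'.
  apply: slice_separated z'y' zy _.
  have := metric_triangle y' x y; rewrite (metric_sym y' x); lra.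
exists [seq (j, z j) | j <- iota 0 (bound x)]; split.
  by rewrite sorted_map; exact: iota_ltn_sorted.
have nz := @nbhs_all X nat (iota 0 (bound x)) (fun j => [set y |
  forall z', slice_nbhd (j, z') y -> z' = z j]) x (fun j _ => zP j).
apply: filterS (filterI (boundP x) nz) => y [yb yz] [j z'] vy.
have jb : j \in iota 0 (bound x).
  rewrite mem_iota add0n leq0n /= ltnNge; apply/negP => /yb; apply.
  by case: vy.
by apply/mapP; exists j => //; rewrite (yz j jb z' vy).
Qed.

Lemma slice_coords_realization x :
  realization_set slice_complex (slice_coords x).
Proof.
have [L [sL /nbhs_singleton Lx]] := slices_near x.
have [Kt tx] := slice_coords_simplex sL Lx.
by exists [seq v <- L | `[< slice_nbhd v x >]].
Qed.

Lemma slice_nbhd_open v : open (slice_nbhd v).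
Proof.
have [ov|nv] := pselect (act_orbit act (c v.1) v.2); last first.
  rewrite (_ : slice_nbhd v = set0); first exact: open0.
  by apply/seteqP; split=> // x [_ _ /nv].
rewrite (_ : slice_nbhd v =
  w v.1 @^-1` [set y | 0 < y] `&` [set x | mdist v.2 x < r v.1]).
  apply: openI; first by apply: open_comp (@open_gt _ 0) => x _; exact: w_cont.
  apply/open_mdist => x /= vx; exists (r v.1 - mdist v.2 x).
    by rewrite subr_gt0.
  move=> y xy; have := metric_triangle v.2 x y; lra.
by apply/seteqP; split=> x [].
Qed.

(** At a point outside the slice, either [w] vanishes, and bounds the coordinate, or
the point lies in another slice of the same index, and the coordinate is 0
nearby. *)
Lemma slice_coords_continuous : continuous slice_coords.
Proof.
apply: continuous_into_prod => v x.
have cq : (w v.1 y / total_weight y) @[y --> x] --> w v.1 x / total_weight x.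
  apply: cvgM; first exact: w_cont.
  apply: cvgV; first by rewrite gt_eqF// total_weight_gt0.
  exact: total_weight_continuous.
have [vx|nvx] := pselect (slice_nbhd v x).
  rewrite /continuous_at (slice_coords_in vx); apply: cvg_trans cq.
  apply: near_eq_cvg.
  have : nbhs x (slice_nbhd v).
    by apply: open_nbhs_nbhs; split=> //; exact: slice_nbhd_open.
  by apply: filterS => y vy; rewrite slice_coords_in.
rewrite /continuous_at (slice_coords_out nvx).
have [w0|wx] := eqVneq (w v.1 x) 0.
  rewrite w0 mul0r in cq.
  apply: (@squeeze_cvgr _ _ _ _ (fun=> 0)
    (fun y => w v.1 y / total_weight y)) => //.
    by near=> y; exact: slice_coords_bound.
  exact: cvg_cst.
have {}wx : 0 < w v.1 x by rewrite lt_neqAle eq_sym wx w_ge0.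
have [z zx] := slice_exists wx.
have h : (fun _ : X => (0 : R)) y @[y --> x] --> (0 : R) by exact: cvg_cst.
apply: cvg_trans h.
apply: near_eq_cvg; apply/nbhs_mdist.
exists (2 * r v.1); first by rewrite mulr_gt0.
move=> y xy; rewrite slice_coords_out// => vy.
have vE : v = (v.1, v.2) by case: (v).
rewrite vE in vy; have zv := slice_separated zx vy xy.
by apply: nvx; rewrite vE -zv.
Unshelve. all: by end_near. Qed.

Definition slice_map x : realization R slice_complex :=
  realization_point (slice_coords_realization x).

(** The coordinates are continuous, but the weak topology is finer than that of
pointwise convergence. Near [x] the images lie in finitely many simplices, those
with vertices in [L], and on each of them the two topologies agree. *)
Lemma slice_map_continuous : continuous slice_map.
Proof.
apply/continuous_closedP => C /closed_realization cC.
rewrite -openC openE => x nCx.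
have [L [sL nL]] := slices_near x.
pose ts := [seq t <- [seq mask (val m) L | m <- enum {: (size L).-tuple bool}]
  | `[< simplex slice_complex t >]].
have nts := @nbhs_all X _ ts (fun t => [set y |
  ~ (closed_simplex t `&` @coords R _ _ _ slice_complex @` C) (slice_coords y)]) x.
have : nbhs x [set y | forall t, t \in ts ->
    ~ (closed_simplex t `&` @coords R _ _ _ slice_complex @` C) (slice_coords y)].
  apply: nts => t; rewrite mem_filter => /andP[/asboolP Kt _].
  have := cC t Kt; rewrite -openC => oC.
  have oP := @open_comp _ _ slice_coords _
    (fun y _ => @slice_coords_continuous y) oC.
  apply: open_nbhs_nbhs; split; first exact: oP.
  move=> [_ [z Cz zx]]; apply: nCx; rewrite /= (_ : slice_map x = z)//.
  exact: coords_inj.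
move=> n2; apply: filterS (filterI nL n2) => y [yL yts] Cy.
have [Kt ty] := slice_coords_simplex sL yL.
apply: (yts [seq v <- L | `[< slice_nbhd v y >]]).
  by rewrite mem_filter asboolT// mem_subseq_enum// filter_subseq.
by split=> //; exists (slice_map y).
Qed.

Lemma slice_map_equivariant :
  equivariant act (@realization_act R _ _ _ slice_complex) slice_map.
Proof.
move=> g x; apply: coords_inj; apply/funext => v.
rewrite coords_act /pt_act /coords /= /slice_coords total_weight_act w_act.
congr (if _ then _ else _); apply/asboolP/asboolP => /slice_nbhd_actV//.
Qed.

End slice_complex.

(** The target when [X] is empty. *)
Definition empty_complex (G : groupType) :
  regular_complex (fun (_ : G) (n : nat) => n).
Proof.
by refine (@RegularComplex G nat (fun _ n => n) _ id _ (fun=> False) _ _ _).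
Defined.

(** * The equivariant map to a complex of dimension at most n *)

Theorem proposition2p6 (R : realType) (G : groupType) (X : metricType R)
    (actX : G -> X -> X) (n : nat)
    (n_ge1 : (1 <= n)%N)
    (X_separable : separable X)
    (X_dim : (covering_dim R X <= n%:R%:E)%E)
    (X_action : is_action actX)
    (X_isometric : isometric_action actX)
    (X_discrete : discrete_action actX) :
  exists (Y : topologicalType) (actY : G -> Y -> Y)
      (cw : GCW_structure R actY) (f : X -> Y),
    [/\ GCW_dim_le cw n,
        forall y : Y, exists x : X, stabilizer actY y `<=` stabilizer actX x,
        continuous f
      & equivariant actX actY f].
Proof.
have [[x0 _]|nX] := pselect (exists x : X, True); last first.
  exists (realization R (empty_complex G)),
    (@realization_act R _ _ _ (empty_complex G)),
    (realization_GCW R (empty_complex G)),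
    (fun x => False_rect _ (nX (ex_intro _ x Logic.I))).
  split.
  - by apply: realization_dim.
  - by move=> y; have [] := coordsP y.
  - by move=> x; case: nX; exists x.
  - by move=> g x; case: nX; exists x.
have [c [r [w [[r0 ci wt] [cw w0 wa] wfin wcov wmult]]]] :=
  invariant_partition x0 X_action X_isometric X_discrete X_separable
    (covering_dim_le X_dim).
pose K := slice_complex X_action X_isometric c r wa.
exists (realization R K), (@realization_act R _ _ _ K), (realization_GCW R K),
  (slice_map X_action X_isometric r0 ci wt w0 wa wfin wcov).
split.
- by apply: realization_dim; exact: slice_simplex_size.
- move=> y; have [s [v [_ _ sv]]] := realization_stabilizer y.
  by exists v.2 => g /sv /(congr1 snd).
- exact: slice_map_continuous.
- exact: slice_map_equivariant.
Qed.
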